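(* Let $d\ge 1$ be an integer and let $p:\mathbb{N}\to[0,1]$ be an $L$-function with $0\le p(n)\ll n^{-d}$. Then $p$ is a convergence law; that is, for every first-order property $P$ of $(d+1)$-uniform hypergraphs, the limit $\lim_{n\to\infty}\mathbb{P}[G^{d+1}(n,p(n))\models P]$ exists.
   Context: $G^{d+1}(n,p)$ is the random $(d+1)$-uniform hypergraph on $n$ labelled vertices in which each of the $\binom{n}{d+1}$ potential edges ($(d+1)$-element vertex sets) is present with probability $p$, independently of the others. First-order (elementary) properties are those expressible by a sentence of first-order logic with equality in the language with one $(d+1)$-ary relation symbol $\sigma$, where quantifiers range over vertices and $\sigma(x_0,\dots,x_d)$ means that $\{x_0,\dots,x_d\}$ is an edge. $f\ll g$ means $f(n)/g(n)\to 0$ as $n\to\infty$. An $L$-function (Hardy's logarithmico-exponential function) is a real-valued function, defined for all large $n$, given by a finite combination of the ordinary algebraic symbols ($+,-,\times,\div$, roots) and the functional symbols $\log(\cdot)$ and $\exp(\cdot)$ applied to the variable $n$ and real constants, such that at all stages of the construction the functions take only real values. *)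

(* Defs.v *)
From HB Require Import structures.
From mathcomp Require Import all_boot all_order all_algebra.
From mathcomp Require Import all_classical all_reals all_analysis.

Set Implicit Arguments.
Unset Strict Implicit.
Unset Printing Implicit Defensive.

Import Order.TTheory GRing.Theory Num.Theory.
Import numFieldNormedType.Exports.

Local Open Scope classical_set_scope.
Local Open Scope ring_scope.

(** First-order logic with equality and one [d.+1]-ary relation symbol. The
    formulas are well scoped: the free variables of [phi : formula d k] are
    indexed by ['I_k], and a quantifier binds the variable [ord0] of its body,
    the variables of the context being shifted by one. *)
Inductive formula (d : nat) : nat -> Type :=
| FFalse k : formula d k
| FEq k : 'I_k -> 'I_k -> formula d k
| FSigma k : ('I_d.+1 -> 'I_k) -> formula d k
| FNot k : formula d k -> formula d k
| FAnd k : formula d k -> formula d k -> formula d k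
| FOr k : formula d k -> formula d k -> formula d k
| FImp k : formula d k -> formula d k -> formula d k
| FForall k : formula d k.+1 -> formula d k
| FExists k : formula d k.+1 -> formula d k.

Definition sentence (d : nat) : Type := formula d 0.

Definition extend (T : Type) (k : nat) (x : T) (v : 'I_k -> T) :
    'I_k.+1 -> T :=
  fun i => if unlift ord0 i is Some j then v j else x.

(** A hypergraph on ['I_n] is given by its set of edges. As edges of a
    [d.+1]-uniform hypergraph have [d.+1] elements, [FSigma] can only hold at
    pairwise distinct vertices. *)
Fixpoint sat (n d k : nat) (H : {set {set 'I_n}}) (phi : formula d k) :
    ('I_k -> 'I_n) -> bool :=
  match phi in formula _ k return ('I_k -> 'I_n) -> bool with
  | FFalse _ => fun=> false
  | FEq _ i j => fun v => v i == v j
  | FSigma _ t => fun v => [set v (t i) | i : 'I_d.+1]%SET \in H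
  | FNot _ f => fun v => ~~ sat H f v
  | FAnd _ f g => fun v => sat H f v && sat H g v
  | FOr _ f g => fun v => sat H f v || sat H g v
  | FImp _ f g => fun v => sat H f v ==> sat H g v
  | FForall _ f => fun v => [forall x, sat H f (extend x v)]
  | FExists _ f => fun v => [exists x, sat H f (extend x v)]
  end.

Definition no_var (T : Type) (i : 'I_0) : T :=
  match notF (ltn_ord i) with end.

Definition models (n d : nat) (H : {set {set 'I_n}}) (P : sentence d) : bool :=
  sat H P (@no_var 'I_n).

Definition potential_edges (d n : nat) : {set {set 'I_n}} :=
  [set e : {set 'I_n} | #|e| == d.+1]%SET.

Definition hypergraph_mass (R : realType) (d n : nat) (q : R)
    (H : {set {set 'I_n}}) : R :=
  \prod_(e in potential_edges d n) (if e \in H then q else 1 - q).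

(** The probability that G^{d+1}(n,q) satisfies [P]. *)
Definition prob_models (R : realType) (d n : nat) (q : R) (P : sentence d) : R :=
  \sum_(H : {set {set 'I_n}} | (H \subset potential_edges d n) && models H P)
    hypergraph_mass d q H.

(** Hardy's logarithmico-exponential functions, as functions of a natural
    number. Side conditions need only hold for all large [n], and values at
    finitely many [n] are irrelevant ([L_germ]). In [L_root], [g] is the real
    [k]-th root of [f], the nonnegative one when [k] is even. *)
Inductive L_function (R : realType) : (nat -> R) -> Prop :=
| L_var : L_function (fun n => n%:R)
| L_const (c : R) : L_function (fun=> c)
| L_add f g : L_function f -> L_function g -> L_function (fun n => f n + g n)
| L_sub f g : L_function f -> L_function g -> L_function (fun n => f n - g n)
| L_mul f g : L_function f -> L_function g -> L_function (fun n => f n * g n)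
| L_div f g : L_function f -> L_function g ->
    (\forall n \near \oo, g n != 0) -> L_function (fun n => f n / g n)
| L_root (k : nat) (f g : nat -> R) : L_function f -> (0 < k)%N ->
    (\forall n \near \oo, g n ^+ k = f n /\ (~~ odd k -> 0 <= g n)) ->
    L_function g
| L_log f : L_function f -> (\forall n \near \oo, 0 < f n) ->
    L_function (fun n => ln (f n))
| L_exp f : L_function f -> L_function (fun n => expR (f n))
| L_germ f g : L_function f -> (\forall n \near \oo, f n = g n) ->
    L_function g.

Definition much_less (R : realType) (f g : nat -> R) : Prop :=
  f n / g n @[n --> \oo] --> (0 : R).

Definition convergence_law (R : realType) (d : nat) (p : nat -> R) : Prop :=
  forall P : sentence d, cvg (prob_models n (p n) P @[n --> \oo]).

(* Main.v *)
Require Import Defs.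
From mathcomp Require Import all_boot all_order all_algebra.
From mathcomp Require Import all_classical all_reals all_analysis.
From mathcomp Require Import ring lra zify.
From mathcomp Require Import fintype finset.

(** Write [x_j(n) = n ^ (d j + 1) p(n) ^ j], which is up to a constant factor
    the expected number of subtrees with [j] edges, and [y(n) = n ^ d p(n)],
    which tends to 0. Since [p] is an L-function, so is [x_j]; L-functions have
    an eventual sign, and applying this to [x_j - c] for all constants [c] shows
    that [x_j] either converges or tends to infinity
    ([L_function_dichotomy]). This is the only use of the shape of [p]. As
    [x_(j+1) = x_j y], either all [x_j] tend to infinity, or there is a [k > 0]
    such that [x_j] tends to infinity for [j < k], converges for [j = k], and
    tends to 0 for [j = k + 1].

    That L-functions have an eventual sign is Hardy's theorem. A Hardy field is
    a field of germs at infinity of differentiable functions that is closed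
    under derivation; its elements have eventual signs. One adjoins
    exponentials and logarithms of its elements: dividing a polynomial in the
    new function by a well chosen coefficient and differentiating gives a
    polynomial with fewer terms, which by induction has an eventual sign, so
    that the polynomial is eventually monotone ([hardy_adjoin_exponential],
    [hardy_adjoin_primitive]).

    The probability that the hypergraph has a cycle is at most a geometric
    series in [y], so that almost surely all components are trees
    ([prob_cyclic]). If [x_j] tends to infinity, each tree with [j] edges
    is almost surely the isomorphism type of many components, by the second
    moment method ([prob_few_copies]).

    A sentence of quantifier rank [r] cannot count components of the same
    rank [r] type beyond [r], by an Ehrenfeucht-Fraisse game ([rich_sat]), and
    there are finitely many such types. If all [x_j] tend to infinity, the
    hypergraph almost surely has [r] components of each type realised by trees,
    and no others: there is a zero-one law ([convergence_all_trees]).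

    Otherwise the trees with less than [k] edges abound, no component has more
    than [k] edges, and the sentence almost surely depends only on the set
    [F] of the edges that lie in components with [k] edges. For a fixed
    possible value [A] of [F], the event [F = A] says that the edges that meet
    the vertices of [A] are those of [A], and that there is no such component
    elsewhere. These conditions are independent, and the probability of the
    second one hardly depends on [A], hence the probability of [F = A] is
    about [p ^ #|A| * Q], where [Q] is the probability that [F] is empty
    ([prob_special_eq]). Summing over the [A] with at most [N] edges
    and a given property, up to isomorphism, gives a convergent sequence times
    [Q]; the other [A] contribute little, by Markov's inequality. For the
    trivial property the sum of the probabilities is 1, so that [Q] converges
    ([no_special_cvg]), and then so does the probability of every property
    of the isomorphism type of [F] ([special_type_cvg]). *)
Set Implicit Arguments.
Unset Strict Implicit.
Unset Printing Implicit Defensive.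

Import Order.TTheory GRing.Theory Num.Theory.
Import numFieldNormedType.Exports.

(** * Hardy fields *)

Section HardyFields.
Local Open Scope classical_set_scope.
Local Open Scope ring_scope.
Variable R : realType.
Implicit Types (f g h y : R -> R) (K : set (R -> R)).

Definition eventual_sign f :=
  [\/ \forall x \near +oo, f x = 0, \forall x \near +oo, 0 < f x
    | \forall x \near +oo, f x < 0].

Definition near_derive f f' :=
  \forall x \near +oo, is_derive (x : R) (1 : R) f (f' x).

(** Germs at infinity are represented by functions on the whole line, hence the
    closure under eventual equality. As [x^-1] is total, closure under inverse
    has no side condition: the inverse of an eventually zero function is
    eventually zero. *)
Record hardy_field K : Prop := HardyField {
  hardy_cst c : K (fun=> c);
  hardy_add f g : K f -> K g -> K (fun x => f x + g x);
  hardy_mul f g : K f -> K g -> K (fun x => f x * g x);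
  hardy_inv f : K f -> K (fun x => (f x)^-1);
  hardy_germ f g : K f -> (\forall x \near +oo, f x = g x) -> K g;
  hardy_derive f : K f -> exists2 f', K f' & near_derive f f';
  hardy_sign f : K f -> eventual_sign f }.

Lemma near_derive_germ f g f' :
  (\forall x \near +oo, f x = g x) -> near_derive f f' -> near_derive g f'.
Proof.
move=> [M [Mr fg]] [N [Nr ff']].
exists (Num.max M N); split; first exact: num_real.
move=> x; rewrite gt_max => /andP[Mx Nx].
apply: near_eq_is_derive (ff' _ Nx).
near=> z; apply: fg; near: z; exact: lt_nbhsr.
Unshelve. all: by end_near. Qed.

Lemma near_derive_germr f f' g' :
  (\forall x \near +oo, f' x = g' x) -> near_derive f f' -> near_derive f g'.
Proof. by move=> fg; apply: filterS2 fg => x ->. Qed.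

Lemma near_deriveD f g f' g' : near_derive f f' -> near_derive g g' ->
  near_derive (fun x => f x + g x) (fun x => f' x + g' x).
Proof. by apply: filterS2 => x ? ?; apply: is_deriveD. Qed.

Lemma near_deriveM f g f' g' : near_derive f f' -> near_derive g g' ->
  near_derive (fun x => f x * g x) (fun x => f' x * g x + f x * g' x).
Proof.
apply: filterS2 => x ? ?; apply: is_derive_eq.
by rewrite /GRing.scale /= addrC mulrC.
Qed.

Lemma near_deriveV f f' : (\forall x \near +oo, f x != 0) ->
  near_derive f f' ->
  near_derive (fun x => (f x)^-1) (fun x => - (f x)^-1 * (f x)^-1 * f' x).
Proof.
apply: filterS2 => x f0 df; apply: is_derive_eq (is_deriveV f0 df) _.
by rewrite /GRing.scale /=; field.
Qed.

Lemma near_derive_cst c : near_derive (fun=> c) (fun=> 0).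
Proof. by apply: nearW => x; exact: is_derive_cst. Qed.

Lemma near_derive_mvt f f' : near_derive f f' ->
  exists M, forall a b, M < a -> a < b ->
    exists2 c, a < c & f b - f a = f' c * (b - a).
Proof.
move=> [M [_ ff']]; exists M => a b Ma ab.
have [||c] := @MVT R f f' a b ab.
- by move=> x; rewrite in_itv /= => /andP[ax _]; apply: ff'; exact: lt_trans ax.
- apply: derivable_within_continuous => x.
  rewrite in_itv /= => /andP[ax _].
  by have [] := ff' _ (lt_le_trans Ma ax).
- by rewrite in_itv /= => /andP[ac _] e; exists c.
Qed.

Lemma sign_of_derive_pos f f' :
  near_derive f f' -> (\forall x \near +oo, 0 < f' x) -> eventual_sign f.
Proof.
move=> /near_derive_mvt[M mvt] [N [_ f'0]].
set L := Num.max M N.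
have incr a b : L < a -> a < b -> f a < f b.
  rewrite /L gt_max => /andP[Ma Na] ab.
  have [c ac e] := mvt _ _ Ma ab.
  by rewrite -subr_gt0 e mulr_gt0 ?subr_gt0// f'0// (lt_trans Na).
have [[a La fa]|noa] := pselect (exists2 a, L < a & 0 <= f a).
  constructor 2; exists a; split; first exact: num_real.
  by move=> x ax; apply: le_lt_trans fa (incr _ _ La ax).
constructor 3; exists L; split; first exact: num_real.
by move=> x Lx; rewrite ltNge; apply/negP => fx; apply: noa; exists x.
Qed.

Lemma eventual_signN f : eventual_sign (fun x => - f x) -> eventual_sign f.
Proof.
case=> H; [constructor 1|constructor 3|constructor 2];
  by apply: filterS H => x; rewrite ?oppr_gt0 ?oppr_lt0// => /eqP;
     rewrite oppr_eq0 => /eqP.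
Qed.

(** Such functions are eventually constant or strictly monotone, and a strictly
    increasing function that is not always negative is eventually positive. *)
Lemma sign_of_derive f f' :
  near_derive f f' -> eventual_sign f' -> eventual_sign f.
Proof.
move=> df [f'0|f'0|f'0].
- have [M mvt] := near_derive_mvt df.
  case: f'0 => N [_ f'0]; set L := Num.max M N.
  have cst a : L + 1 < a -> f a = f (L + 1).
    move=> La; have LL : L < L + 1 by rewrite ltrDl.
    have := LL; rewrite {1}/L gt_max => /andP[ML NL].
    have [c Lc /eqP] := mvt _ _ ML La.
    by rewrite f'0 ?mul0r ?subr_eq0 => [/eqP//|]; exact: lt_trans Lc.
  have nearf : \forall x \near +oo, f x = f (L + 1).
    by exists (L + 1); split; [exact: num_real|exact: cst].
  have [e|e|e] := ltgtP (f (L + 1)) 0;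
    [constructor 3|constructor 2|constructor 1];
    by apply: filterS nearf => x ->.
- exact: sign_of_derive_pos df f'0.
- apply/eventual_signN/(@sign_of_derive_pos _ (fun x => - f' x)).
    by apply: filterS df => x ?; exact: is_deriveN.
  by apply: filterS f'0 => x; rewrite oppr_gt0.
Qed.

Lemma eventual_sign_mul f g :
  eventual_sign f -> eventual_sign g -> eventual_sign (fun x => f x * g x).
Proof.
move=> [f0|f0|f0] [g0|g0|g0];
  try (by constructor 1; apply: filterS f0 => x ->; rewrite mul0r);
  try (by constructor 1; apply: filterS g0 => x ->; rewrite mulr0).
- by constructor 2; apply: filterS2 f0 g0 => x; exact: mulr_gt0.
- by constructor 3; apply: filterS2 f0 g0 => x ? ?; rewrite pmulr_rlt0.
- by constructor 3; apply: filterS2 f0 g0 => x ? ?; rewrite pmulr_llt0.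
- by constructor 2; apply: filterS2 f0 g0 => x ? ?; rewrite nmulr_rgt0.
Qed.

Lemma eventual_sign_germ f g : (\forall x \near +oo, f x = g x) ->
  eventual_sign f -> eventual_sign g.
Proof.
move=> fg [f0|f0|f0]; [constructor 1|constructor 2|constructor 3];
  by apply: filterS2 fg f0 => x ->.
Qed.

Lemma eventual_sign_neq0 f : eventual_sign f ->
  (\forall x \near +oo, f x = 0) \/ (\forall x \near +oo, f x != 0).
Proof.
case=> f0; [by left|right|right].
- by apply: filterS f0 => x; exact: lt0r_neq0.
- by apply: filterS f0 => x; exact: ltr0_neq0.
Qed.

Lemma hardy_opp K f : hardy_field K -> K f -> K (fun x => - f x).
Proof.
move=> HK Kf; apply: (hardy_germ HK) (hardy_mul HK (hardy_cst HK (-1)) Kf) _.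
by apply: nearW => x /=; rewrite mulN1r.
Qed.

Lemma hardy_sub K f g :
  hardy_field K -> K f -> K g -> K (fun x => f x - g x).
Proof. by move=> HK Kf Kg; exact: hardy_add Kf (hardy_opp HK Kg). Qed.

(** All other Hardy fields arise from this one by adjunctions, the first of
    which is that of the identity, a primitive of 1. *)
Lemma hardy_constants :
  hardy_field [set f | exists c, \forall x \near +oo, f x = c].
Proof.
split => /=.
- by move=> c; exists c; exact: nearW.
- move=> f g [a fa] [b gb]; exists (a + b).
  by apply: filterS2 fa gb => x -> ->.
- move=> f g [a fa] [b gb]; exists (a * b).
  by apply: filterS2 fa gb => x -> ->.
- by move=> f [a fa]; exists a^-1; apply: filterS fa => x ->.
- by move=> f g [a fa] fg; exists a; apply: filterS2 fa fg => x -> ->.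
- move=> f [a fa]; exists (fun=> 0); first by exists 0; exact: nearW.
  apply: near_derive_germ (near_derive_cst a).
  by apply: filterS fa => x ->.
- move=> f [a fa]; have [e|e|e] := ltgtP a 0;
    [constructor 3|constructor 2|constructor 1];
    by apply: filterS fa => x ->.
Qed.

Section SimpleExtension.
Variables (K : set (R -> R)) (y : R -> R).
Hypothesis HK : hardy_field K.

(** The polynomials in [y] over [K] are filtered by their number of terms, on
    which the sign of a polynomial is studied by induction. *)
Definition hardy_poly n : set (R -> R) := [set h |
  exists2 a : nat -> R -> R, (forall i, K (a i)) &
    \forall x \near +oo, h x = \sum_(i < n) a i x * y x ^+ i].

Lemma hardy_poly_germ n f g : hardy_poly n f ->
  (\forall x \near +oo, f x = g x) -> hardy_poly n g.
Proof.
by move=> [a Ka fa] fg; exists a => //; apply: filterS2 fa fg => x <-.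
Qed.

Lemma hardy_poly0 n f : (\forall x \near +oo, f x = 0) -> hardy_poly n f.
Proof.
move=> f0; exists (fun _ _ => 0); first by move=> i; exact: (hardy_cst HK).
by apply: filterS f0 => x ->; rewrite big1// => i _; rewrite mul0r.
Qed.

Lemma hardy_polyD n f g : hardy_poly n f -> hardy_poly n g ->
  hardy_poly n (fun x => f x + g x).
Proof.
move=> [a Ka fa] [b Kb gb]; exists (fun i x => a i x + b i x).
  by move=> i; exact: (hardy_add HK).
apply: filterS2 fa gb => x -> ->; rewrite -big_split /=.
by apply: eq_bigr => i _; rewrite mulrDl.
Qed.

Lemma hardy_polyZ n c f : K c -> hardy_poly n f ->
  hardy_poly n (fun x => c x * f x).
Proof.
move=> Kc [a Ka fa]; exists (fun i x => c x * a i x).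
  by move=> i; exact: (hardy_mul HK).
apply: filterS fa => x ->; rewrite mulr_sumr.
by apply: eq_bigr => i _; rewrite mulrA.
Qed.

(** The constant term is split off here, which suits exponentials, and the
    leading term in [hardy_poly_recr], which suits primitives. *)
Lemma hardy_poly_recl n f : hardy_poly n.+1 f <->
  exists a g, [/\ K a, hardy_poly n g &
    \forall x \near +oo, f x = a x + y x * g x].
Proof.
split=> [[a Ka fa]|[b [g [Kb [a Ka ga] fg]]]].
  exists (a 0), (fun x => \sum_(i < n) a i.+1 x * y x ^+ i); split => //.
    by exists (fun i => a i.+1) => [i|]; [exact: Ka|exact: nearW].
  apply: filterS fa => x ->; rewrite big_ord_recl expr0 mulr1 mulr_sumr.
  by congr (_ + _); apply: eq_bigr => i _; rewrite exprS mulrCA.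
exists (fun i => if i is j.+1 then a j else b); first by case.
apply: filterS2 ga fg => x gx ->; rewrite big_ord_recl expr0 mulr1 gx mulr_sumr.
by congr (_ + _); apply: eq_bigr => i _; rewrite exprS mulrCA.
Qed.

Lemma hardy_poly_recr n f : hardy_poly n.+1 f <->
  exists a g, [/\ K a, hardy_poly n g &
    \forall x \near +oo, f x = g x + a x * y x ^+ n].
Proof.
split=> [[a Ka fa]|[b [g [Kb [a Ka ga] fg]]]].
  exists (a n), (fun x => \sum_(i < n) a i x * y x ^+ i); split => //.
    by exists a => //; apply: nearW => x.
  by apply: filterS fa => x ->; rewrite big_ord_recr.
exists (fun i => if (i < n)%N then a i else b); first by move=> i; case: ifP.
apply: filterS2 ga fg => x gx ->; rewrite big_ord_recr /= ltnn gx.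
by congr (_ + _); apply: eq_bigr => i _; rewrite ltn_ord.
Qed.

Lemma hardy_poly_K a : K a -> hardy_poly 1 a.
Proof.
move=> Ka; apply/hardy_poly_recl; exists a, (fun=> 0); split => //.
  by apply: hardy_poly0; exact: nearW.
by apply: nearW => x; rewrite mulr0 addr0.
Qed.

Lemma hardy_poly_widen m n f : (m <= n)%N -> hardy_poly m f -> hardy_poly n f.
Proof.
move=> /subnK <-; elim: (n - m)%N => // k IH /IH {}IH.
rewrite addSn; apply/hardy_poly_recr; exists (fun=> 0), f; split => //.
  exact: (hardy_cst HK).
by apply: nearW => x; rewrite mul0r addr0.
Qed.

Lemma hardy_poly_mulX n f : hardy_poly n f ->
  hardy_poly n.+1 (fun x => y x * f x).
Proof.
move=> Pf; apply/hardy_poly_recl; exists (fun=> 0), f; split => //.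
  exact: (hardy_cst HK).
by apply: nearW => x; rewrite add0r.
Qed.

Definition hardy_polys : set (R -> R) := [set f | exists n, hardy_poly n f].

Lemma hardy_polysD f g : hardy_polys f -> hardy_polys g ->
  hardy_polys (fun x => f x + g x).
Proof.
move=> [m Pf] [n Pg]; exists (maxn m n).
by apply: hardy_polyD; [apply: hardy_poly_widen Pf|apply: hardy_poly_widen Pg];
  rewrite ?leq_maxl ?leq_maxr.
Qed.

Lemma hardy_polysM f g : hardy_polys f -> hardy_polys g ->
  hardy_polys (fun x => f x * g x).
Proof.
move=> [m Pf] Qg; elim: m f Pf => [|m IH] f Pf.
  exists 0; apply: hardy_poly0; case: Pf => a _.
  by apply: filterS => x ->; rewrite big_ord0 mul0r.
case/hardy_poly_recl: Pf => a [h [Ka Ph fh]].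
have [n Pg] := Qg; have [k Phg] := IH _ Ph.
have [p Pp] : hardy_polys (fun x => a x * g x + y x * (h x * g x)).
  apply: hardy_polysD; first by exists n; exact: hardy_polyZ.
  by exists k.+1; exact: hardy_poly_mulX.
exists p; apply: hardy_poly_germ Pp _.
by apply: filterS fh => x ->; rewrite mulrDl mulrA.
Qed.

Hypothesis poly_derive : forall f, hardy_polys f ->
  exists2 f', hardy_polys f' & near_derive f f'.
Hypothesis poly_sign : forall f, hardy_polys f -> eventual_sign f.

Definition hardy_adjoin : set (R -> R) := [set h | exists f g,
  [/\ hardy_polys f, hardy_polys g, \forall x \near +oo, g x != 0 &
      \forall x \near +oo, h x = f x / g x]].

Lemma hardy_adjoin_poly f : hardy_polys f -> hardy_adjoin f.
Proof.
move=> Pf; exists f, (fun=> 1); split => //.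
- by exists 1%N; apply: hardy_poly_K; exact: (hardy_cst HK).
- by apply: nearW => x; rewrite oner_neq0.
- by apply: nearW => x; rewrite divr1.
Qed.

Lemma hardy_adjoin_sub : K `<=` hardy_adjoin.
Proof. by move=> a Ka; apply: hardy_adjoin_poly; exists 1%N; exact: hardy_poly_K. Qed.

Lemma hardy_adjoin_gen : hardy_adjoin y.
Proof.
apply: hardy_adjoin_poly; exists 2.
apply: hardy_poly_germ (hardy_poly_mulX (hardy_poly_K (hardy_cst HK 1))) _.
by apply: nearW => x /=; rewrite mulr1.
Qed.

(** Derivatives and signs are only required of polynomials: a quotient has the
    sign of the product of its numerator and its denominator. *)
Lemma hardy_adjoin_field : hardy_field hardy_adjoin.
Proof.
have polyN f : hardy_polys f -> hardy_polys (fun x => (-1) * f x).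
  by move=> [n Pf]; exists n; apply: hardy_polyZ => //; exact: (hardy_cst HK).
split.
- by move=> c; apply: hardy_adjoin_sub; exact: (hardy_cst HK).
- move=> h1 h2 [f1 [g1 [Pf1 Pg1 g10 e1]]] [f2 [g2 [Pf2 Pg2 g20 e2]]].
  exists (fun x => f1 x * g2 x + f2 x * g1 x), (fun x => g1 x * g2 x); split.
  + by apply: hardy_polysD; exact: hardy_polysM.
  + exact: hardy_polysM.
  + by apply: filterS2 g10 g20 => x ? ?; exact: mulf_neq0.
  + apply: filterS2 (filterI g10 g20) (filterI e1 e2) => x [g1x g2x] [-> ->].
    by field; rewrite g1x g2x.
- move=> h1 h2 [f1 [g1 [Pf1 Pg1 g10 e1]]] [f2 [g2 [Pf2 Pg2 g20 e2]]].
  exists (fun x => f1 x * f2 x), (fun x => g1 x * g2 x); split.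
  + exact: hardy_polysM.
  + exact: hardy_polysM.
  + by apply: filterS2 g10 g20 => x ? ?; exact: mulf_neq0.
  + apply: filterS2 (filterI g10 g20) (filterI e1 e2) => x [g1x g2x] [-> ->].
    by field; rewrite g1x g2x.
- move=> h [f [g [Pf Pg g0 e]]].
  have [f0|f0] := eventual_sign_neq0 (poly_sign Pf).
    apply: hardy_adjoin_poly; exists 0; apply: hardy_poly0.
    by apply: filterS2 e f0 => x -> ->; rewrite mul0r invr0.
  by exists g, f; split => //; apply: filterS e => x ->; rewrite invf_div.
- move=> h1 h2 [f [g [Pf Pg g0 e]]] hh; exists f, g; split => //.
  by apply: filterS2 hh e => x ->.
- move=> h [f [g [Pf Pg g0 e]]].
  have [f' Pf' df] := poly_derive Pf; have [g' Pg' dg] := poly_derive Pg.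
  exists (fun x => f' x * (g x)^-1 + f x * (- (g x)^-1 * (g x)^-1 * g' x)).
    exists (fun x => f' x * g x + (-1) * (f x * g' x)), (fun x => g x * g x).
    split.
    + by apply: hardy_polysD; [|apply: polyN]; exact: hardy_polysM.
    + exact: hardy_polysM.
    + by apply: filterS g0 => x ?; exact: mulf_neq0.
    + by apply: filterS g0 => x gx; field.
  apply: near_derive_germ (near_deriveM df (near_deriveV g0 dg)).
  by apply: filterS e => x ->.
- move=> h [f [g [Pf Pg g0 e]]].
  suff S : eventual_sign (fun x => f x * g x).
    apply: (@eventual_sign_germ (fun x => f x * g x * ((g x)^-1 * (g x)^-1))).
      by apply: filterS2 g0 e => x gx ->; field.
    apply: eventual_sign_mul => //; constructor 2.
    by apply: filterS g0 => x gx; rewrite -expr2 exprn_even_gt0// invr_neq0.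
  by apply: poly_sign; exact: hardy_polysM.
Qed.


Lemma hardy_poly_monomial n i c : K c -> (i < n)%N ->
  hardy_poly n (fun x => c x * y x ^+ i).
Proof.
move=> Kc /hardy_poly_widen; apply; apply/hardy_poly_recr.
exists c, (fun=> 0); split => //; first by apply: hardy_poly0; exact: nearW.
by apply: nearW => x; rewrite add0r.
Qed.

Lemma near_derive_pow b n : near_derive y b ->
  near_derive (fun x => y x ^+ n) (fun x => n%:R * b x * y x ^+ n.-1).
Proof.
move=> dy; elim: n => [|n IH].
  apply: near_derive_germr (near_derive_cst 1).
  by apply: nearW => x; rewrite !mul0r.
apply: near_derive_germ (near_derive_germr _ (near_deriveM dy IH)).
  by apply: nearW => x; rewrite exprS.
by apply: nearW => x /=; case: n {IH} => [|n] /=; rewrite ?exprS; ring.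
Qed.

End SimpleExtension.

(** Dividing a polynomial in [y] by its leading coefficient gives a monic polynomial, whose derivative
    has smaller degree; it is thus eventually monotone, by induction. *)
Lemma hardy_adjoin_primitive K y b :
    hardy_field K -> K b -> near_derive y b ->
  exists K', [/\ hardy_field K', K `<=` K' & K' y].
Proof.
move=> HK Kb dy.
have poly_derive n f : hardy_poly K y n f ->
    exists2 f', hardy_poly K y n f' & near_derive f f'.
  elim: n f => [|n IH] f.
    move=> [a _ f0]; exists (fun=> 0); first by apply: hardy_poly0 => //; exact: nearW.
    apply: near_derive_germ (near_derive_cst 0).
    by apply: filterS f0 => x ->; rewrite big_ord0.
  case/hardy_poly_recr => // a [g [Ka Pg fE]].
  have [g' Pg' dg] := IH _ Pg.
  have [a' Ka' da] := hardy_derive HK Ka.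
  have := near_deriveD dg (near_deriveM da (near_derive_pow n dy)).
  set f' := (f' in near_derive _ f') => df; exists f'; last first.
    by apply: near_derive_germ df; apply: filterS fE => x ->.
  apply: (hardy_polyD HK); first exact: (hardy_poly_widen HK (leqnSn n)).
  apply: (hardy_polyD HK); first exact: hardy_poly_monomial.
  case: n {f' df IH Pg Pg' fE} => [|n].
    by apply: (hardy_poly0 _ HK); apply: nearW => x; rewrite !mul0r mulr0.
  apply: (@hardy_poly_germ _ _ _ (fun x => a x * (n.+1%:R * b x) * y x ^+ n)).
    apply: hardy_poly_monomial => //.
    by apply: (hardy_mul HK) => //; apply: (hardy_mul HK) => //; exact: (hardy_cst HK).
  by apply: nearW => x; rewrite /= -mulrA.
have poly_sign n f : hardy_poly K y n f -> eventual_sign f.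
  elim: n f => [|n IH] f.
    by move=> [a _ f0]; constructor 1; apply: filterS f0 => x ->; rewrite big_ord0.
  case/hardy_poly_recr => // a [g [Ka Pg fE]].
  have sa := hardy_sign HK Ka.
  have [a0|a0] := eventual_sign_neq0 sa.
    apply: eventual_sign_germ (IH _ Pg).
    by apply: filterS2 a0 fE => x -> ->; rewrite mul0r addr0.
  have Pga : hardy_poly K y n (fun x => (a x)^-1 * g x).
    by apply: (hardy_polyZ HK) => //; exact: (hardy_inv HK).
  have [h Ph dh] := poly_derive _ _ Pga.
  have sfa : eventual_sign (fun x => (a x)^-1 * g x + y x ^+ n).
    apply: sign_of_derive (near_deriveD dh (near_derive_pow n dy)) _.
    apply: IH; apply: (hardy_polyD HK) => //.
    case: n {Pg Pga Ph dh fE} => [|n].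
      by apply: (hardy_poly0 _ HK); apply: nearW => x; rewrite !mul0r.
    apply: hardy_poly_monomial => //.
    by apply: (hardy_mul HK) => //; exact: (hardy_cst HK).
  apply: eventual_sign_germ (eventual_sign_mul sa sfa).
  by apply: filterS2 a0 fE => x ? ->; field.
exists (hardy_adjoin K y); split.
- apply: hardy_adjoin_field => // f [n Pf]; last exact: poly_sign Pf.
  by have [f' Pf' df] := poly_derive _ _ Pf; exists f' => //; exists n.
- exact: hardy_adjoin_sub.
- exact: hardy_adjoin_gen.
Qed.

(** Dividing a polynomial in [y] by its constant coefficient makes that coefficient equal to 1, and then the derivative is
    [y] times a polynomial with one term less. *)
Lemma hardy_adjoin_exponential K y b :
    hardy_field K -> K b -> near_derive y (fun x => b x * y x) ->
    (\forall x \near +oo, 0 < y x) ->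
  exists K', [/\ hardy_field K', K `<=` K' & K' y].
Proof.
move=> HK Kb dy y0.
have poly_derive n f : hardy_poly K y n f ->
    exists2 f', hardy_poly K y n f' & near_derive f f'.
  elim: n f => [|n IH] f.
    move=> [a _ f0]; exists (fun=> 0); first by apply: hardy_poly0 => //; exact: nearW.
    apply: near_derive_germ (near_derive_cst 0).
    by apply: filterS f0 => x ->; rewrite big_ord0.
  case/hardy_poly_recl => // a [g [Ka Pg fE]].
  have [g' Pg' dg] := IH _ Pg.
  have [a' Ka' da] := hardy_derive HK Ka.
  exists (fun x => a' x + y x * (b x * g x + g' x)).
    apply/hardy_poly_recl => //; exists a', (fun x => b x * g x + g' x).
    split => //; last exact: nearW.
    by apply: (hardy_polyD HK) => //; exact: (hardy_polyZ HK).
  apply: (@near_derive_germ (fun x => a x + y x * g x)).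
    by apply: filterS fE => x ->.
  apply: near_derive_germr (near_deriveD da (near_deriveM dy dg)).
  by apply: nearW => x; ring.
have poly_sign n f : hardy_poly K y n f -> eventual_sign f.
  elim: n f => [|n IH] f.
    by move=> [a _ f0]; constructor 1; apply: filterS f0 => x ->; rewrite big_ord0.
  case/hardy_poly_recl => // a [g [Ka Pg fE]].
  have sa := hardy_sign HK Ka.
  have sy : eventual_sign y by constructor 2.
  have [a0|a0] := eventual_sign_neq0 sa.
    apply: eventual_sign_germ (eventual_sign_mul sy (IH _ Pg)).
    by apply: filterS2 a0 fE => x -> ->; rewrite add0r.
  have Pga : hardy_poly K y n (fun x => (a x)^-1 * g x).
    by apply: (hardy_polyZ HK) => //; exact: (hardy_inv HK).
  have [h Ph dh] := poly_derive _ _ Pga.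
  have sfa : eventual_sign (fun x => 1 + y x * ((a x)^-1 * g x)).
    apply: sign_of_derive (near_deriveD (near_derive_cst 1) (near_deriveM dy dh)) _.
    have Q : hardy_poly K y n (fun x => b x * ((a x)^-1 * g x) + h x).
      by apply: (hardy_polyD HK) => //; exact: (hardy_polyZ HK).
    apply: eventual_sign_germ (eventual_sign_mul sy (IH _ Q)).
    by apply: nearW => x; ring.
  apply: eventual_sign_germ (eventual_sign_mul sa sfa).
  by apply: filterS2 a0 fE => x ? ->; field.
exists (hardy_adjoin K y); split.
- apply: hardy_adjoin_field => // f [n Pf]; last exact: poly_sign Pf.
  by have [f' Pf' df] := poly_derive _ _ Pf; exists f' => //; exists n.
- exact: hardy_adjoin_sub.
- exact: hardy_adjoin_gen.
Qed.

Lemma hardy_adjoin_exp K f : hardy_field K -> K f ->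
  exists K', [/\ hardy_field K', K `<=` K' & K' (fun x => expR (f x))].
Proof.
move=> HK Kf; have [f' Kf' df] := hardy_derive HK Kf.
apply: (hardy_adjoin_exponential HK Kf'); last by apply: nearW => x; exact: expR_gt0.
apply: filterS df => x dfx.
apply: is_derive_eq (@is_derive1_comp R expR f x _ _ (is_derive_expR _) dfx) _.
by rewrite mulrC.
Qed.

Lemma hardy_adjoin_ln K f : hardy_field K -> K f ->
    (\forall x \near +oo, 0 < f x) ->
  exists K', [/\ hardy_field K', K `<=` K' & K' (fun x => ln (f x))].
Proof.
move=> HK Kf f0; have [f' Kf' df] := hardy_derive HK Kf.
apply: (hardy_adjoin_primitive HK (hardy_mul HK (hardy_inv HK Kf) Kf')).
apply: filterS2 f0 df => x fx dfx.
exact: (@is_derive1_comp R (@ln R) f x _ _ (is_derive1_ln fx) dfx).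
Qed.

Lemma hardy_identity : exists2 K, hardy_field K & K id.
Proof.
have [||K [HK _ Kid]] :=
  @hardy_adjoin_primitive _ id (fun=> 1) hardy_constants.
- by exists 1; exact: nearW.
- by apply: nearW => x; exact: is_derive_id.
by exists K.
Qed.

End HardyFields.

(** * L-functions have limits *)

Section LFunctions.
Local Open Scope classical_set_scope.
Local Open Scope ring_scope.
Variable R : realType.
Implicit Types (u : nat -> R) (K : set (R -> R)).

Lemma near_pinfty_natr (P : set R) :
  (\forall x \near +oo, P x) -> \forall n \near \oo, P n%:R.
Proof.
move=> [M [_ MP]]; near=> n; apply: MP; near: n; exact: nbhs_infty_gtr.
Unshelve. all: by end_near. Qed.

(** Roots of positive functions are obtained from logarithms and exponentials. *)
Lemma hardy_adjoin_root K f k : hardy_field K -> K f -> (0 < k)%N ->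
    (\forall x \near +oo, 0 < f x) ->
  exists K' g, [/\ hardy_field K', K `<=` K', K' g,
    \forall x \near +oo, 0 < g x & \forall x \near +oo, g x ^+ k = f x].
Proof.
move=> HK Kf k0 f0; have [K1 [HK1 sub1 K1l]] := hardy_adjoin_ln HK Kf f0.
have [K2 [HK2 sub2 K2g]] :=
  hardy_adjoin_exp HK1 (hardy_mul HK1 (hardy_cst HK1 k%:R^-1) K1l).
exists K2, (fun x => expR (k%:R^-1 * ln (f x))); split=> //.
- by move=> h /sub1/sub2.
- by apply: nearW => x; exact: expR_gt0.
- apply: filterS f0 => x fx.
  by rewrite -expRM_natl mulrA divff ?mul1r ?lnK// pnatr_eq0 -lt0n.
Qed.

(** Allowing any initial Hardy field makes room for
    the two arguments of a binary operation in one and the same field. *)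
Lemma L_function_hardy u : L_function u ->
  forall K, hardy_field K -> K id -> exists K' F,
    [/\ hardy_field K', K `<=` K', K' F & \forall n \near \oo, F n%:R = u n].
Proof.
have binary (op : (R -> R -> R)) f g :
    (forall K F G, hardy_field K -> K F -> K G -> K (fun x => op (F x) (G x))) ->
    (forall K, hardy_field K -> K id -> exists K' F,
      [/\ hardy_field K', K `<=` K', K' F & \forall n \near \oo, F n%:R = f n]) ->
    (forall K, hardy_field K -> K id -> exists K' F,
      [/\ hardy_field K', K `<=` K', K' F & \forall n \near \oo, F n%:R = g n]) ->
    forall K, hardy_field K -> K id -> exists K' F,
      [/\ hardy_field K', K `<=` K', K' F &
        \forall n \near \oo, F n%:R = op (f n) (g n)].
  move=> Hop IHf IHg K HK Kid.
  have [K1 [F [HK1 s1 K1F Ff]]] := IHf _ HK Kid.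
  have [K2 [G [HK2 s2 K2G Gg]]] := IHg _ HK1 (s1 _ Kid).
  exists K2, (fun x => op (F x) (G x)); split => //.
  - by move=> h /s1/s2.
  - by apply: Hop => //; exact: s2.
  - by apply: filterS2 Ff Gg => n -> ->.
elim=> {u} [|c|f g _ IHf _ IHg|f g _ IHf _ IHg|f g _ IHf _ IHg
  |f g _ IHf _ IHg _|k f g _ IHf k0 gf|f _ IHf f0|f _ IHf|f g _ IHf fg].
- by move=> K HK Kid; exists K, id; split => //; by apply: nearW.
- move=> K HK Kid; exists K, (fun=> c); split => //; last by apply: nearW.
  exact: (hardy_cst HK).
- by apply: (binary (fun a b => a + b)) IHf IHg => K F G HK; exact: (hardy_add HK).
- by apply: (binary (fun a b => a - b)) IHf IHg => K F G; exact: hardy_sub.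
- by apply: (binary (fun a b => a * b)) IHf IHg => K F G HK; exact: (hardy_mul HK).
- apply: (binary (fun a b => a / b)) IHf IHg => K F G HK KF KG.
  by apply: (hardy_mul HK) => //; exact: (hardy_inv HK).
- move=> K HK Kid; have [K1 [F [HK1 s1 K1F Ff]]] := IHf _ HK Kid.
  case: (hardy_sign HK1 K1F) => F0.
  + exists K1, (fun=> 0); split => //; first exact: (hardy_cst HK1).
    have F0n := near_pinfty_natr F0.
    apply: filterS2 F0n (filterI Ff gf) => n Fn [<- []]; rewrite Fn => /eqP; rewrite expf_eq0.
    by move=> /andP[_ /eqP ->].
  + have [K2 [G [HK2 s2 K2G G0 GF]]] := hardy_adjoin_root HK1 K1F k0 F0.
    exists K2, G; split => //; first by move=> h /s1/s2.
    have H : \forall n \near \oo, [/\ 0 < F n%:R, 0 < G n%:R & G n%:R ^+ k = F n%:R].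
      apply: (@near_pinfty_natr (fun x => [/\ 0 < F x, 0 < G x & G x ^+ k = F x])).
      by apply: filterS3 F0 G0 GF.
    apply: filterS2 H (filterI Ff gf) => n [Fn Gn GFn] [Fnf [gk g0]].
    apply: (@pexpIrn _ k) => //; rewrite ?nnegrE ?(ltW Gn) //; last first.
      by rewrite GFn gk Fnf.
    case: (boolP (odd k)) => [ok|/g0//].
    by move: Fn; rewrite Fnf -gk exprn_odd_gt0// => /ltW.
  + have [|K2 [G [HK2 s2 K2G G0 GF]]] :=
        hardy_adjoin_root HK1 (hardy_opp HK1 K1F) k0.
      by apply: filterS F0 => x; rewrite oppr_gt0.
    exists K2, (fun x => - G x); split => //; first by move=> h /s1/s2.
      exact: hardy_opp.
    have H : \forall n \near \oo, [/\ F n%:R < 0, 0 < G n%:R & G n%:R ^+ k = - F n%:R].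
      apply: (@near_pinfty_natr (fun x => [/\ F x < 0, 0 < G x & G x ^+ k = - F x])).
      by apply: filterS3 F0 G0 GF.
    apply: filterS2 H (filterI Ff gf) => n [Fn Gn GFn] [Fnf [gk g0]].
    have ok : odd k.
      by apply/negPn/negP => ek; move: Fn; rewrite Fnf -gk real_exprn_even_lt0 // ?num_real.
    have gn : g n < 0 by move: Fn; rewrite Fnf -gk exprn_odd_lt0.
    apply: oppr_inj; rewrite opprK; apply: (@pexpIrn _ k) => //.
    * by rewrite nnegrE ltW.
    * by rewrite nnegrE oppr_ge0 ltW.
    * by rewrite GFn exprNn -signr_odd ok expr1 mulN1r gk Fnf.
- move=> K HK Kid; have [K1 [F [HK1 s1 K1F Ff]]] := IHf _ HK Kid.
  have contra : (\forall x \near +oo, F x <= 0) -> False.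
    move=> /near_pinfty_natr F0; have /filter_ex[n [Fn [e fn]]] :
      \forall n \near \oo, F n%:R <= 0 /\ F n%:R = f n /\ 0 < f n.
      by apply: filterS3 F0 Ff f0.
    by move: Fn; rewrite e leNgt fn.
  case: (hardy_sign HK1 K1F) => F0.
  + by exfalso; apply: contra; apply: filterS F0 => x ->.
  + have [K2 [HK2 s2 K2l]] := hardy_adjoin_ln HK1 K1F F0.
    exists K2, (fun x => ln (F x)); split => //; first by move=> h /s1/s2.
    by apply: filterS Ff => n ->.
  + by exfalso; apply: contra; apply: filterS F0 => x /ltW.
- move=> K HK Kid; have [K1 [F [HK1 s1 K1F Ff]]] := IHf _ HK Kid.
  have [K2 [HK2 s2 K2e]] := hardy_adjoin_exp HK1 K1F.
  exists K2, (fun x => expR (F x)); split => //; first by move=> h /s1/s2.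
  by apply: filterS Ff => n ->.
- move=> K HK Kid; have [K1 [F [HK1 s1 K1F Ff]]] := IHf _ HK Kid.
  by exists K1, F; split => //; apply: filterS2 Ff fg => n ->.
Qed.

Lemma L_function_sign u : L_function u ->
  (\forall n \near \oo, u n <= 0) \/ (\forall n \near \oo, 0 < u n).
Proof.
move=> Lu; have [K HK Kid] := hardy_identity R.
have [K' [F [HK' _ K'F Fu]]] := L_function_hardy Lu HK Kid.
case: (hardy_sign HK' K'F) => /near_pinfty_natr F0; [left|right|left];
  apply: filterS2 F0 Fu => n; first by move=> -> <-.
- by move=> ? <-.
- by move=> /ltW ? <-.
Qed.

(** The function [u - c] has an eventual sign for all constants [c]. Thus, if
    [u] is bounded, it converges to the infimum of its eventual upper bounds. *)
Lemma L_function_dichotomy u : L_function u ->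
    (\forall n \near \oo, 0 <= u n) ->
  u n @[n --> \oo] --> +oo \/ cvg (u n @[n --> \oo]).
Proof.
move=> Lu u0.
have cmp c : (\forall n \near \oo, u n <= c) \/ (\forall n \near \oo, c < u n).
  have [H|H] := L_function_sign (L_sub Lu (L_const c)); [left|right];
  by apply: filterS H => n; rewrite ?subr_le0 ?subr_gt0.
have [[C uC]|unb] := pselect (exists C, \forall n \near \oo, u n <= C); last first.
  left; apply/cvgryPgt => A.
  by case: (cmp A) => // uA; case: unb; exists A.
right; pose S := [set c | \forall n \near \oo, u n <= c].
have S0 : lbound S 0.
  move=> c uc; have /filter_ex[n] : \forall n \near \oo, 0 <= c by apply: filterS2 u0 uc => n; exact: le_trans.
  exact.
have Sinf : has_inf S by split; [exists C|exists 0].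
apply/cvg_ex; exists (inf S); apply/cvgrPdist_le => e e0.
have up : \forall n \near \oo, u n <= inf S + e.
  have [c Sc cS] := inf_adherent e0 Sinf.
  by apply: filterS Sc => n un; apply: le_trans un (ltW cS).
have lo : \forall n \near \oo, inf S - e < u n.
  case: (cmp (inf S - e)) => // H.
  have := ge_inf (proj2 Sinf) H; rewrite lerBrDr gerDl => /le_gtF.
  by rewrite e0.
apply: filterS2 up lo => n h1 h2; rewrite ler_distlC; apply/andP; split; lra.
Qed.

End LFunctions.

(** * Components and trees of a hypergraph *)

Section Components.
Variable V : finType.
Implicit Types (H E : {set {set V}}) (S T U e : {set V}) (x y a b : V).

Definition touch H S : {set {set V}} := [set e in H | ~~ [disjoint e & S]].

Definition inside H S : {set {set V}} := [set e in H | e \subset S].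

(** [S] is a union of connected components. *)
Definition closed_in H S := [forall e in H, ~~ [disjoint e & S] ==> (e \subset S)].

(** The smallest union of components that contains [x] is a component; this
    definition of components does without paths. *)
Definition component H x : {set V} := \bigcap_(S | closed_in H S && (x \in S)) S.

Lemma meets_witness e S : ~~ [disjoint e & S] -> exists2 x, x \in e & x \in S.
Proof. by case/pred0Pn => x /andP[? ?]; exists x. Qed.

Lemma meets_intro x e S : x \in e -> x \in S -> ~~ [disjoint e & S].
Proof. by move=> xe xS; apply/pred0Pn; exists x; rewrite /= xe. Qed.

Lemma closed_inP H S :
  reflect (forall e x, e \in H -> x \in e -> x \in S -> e \subset S)
          (closed_in H S).
Proof.
apply: (iffP forall_inP) => [HS e x eH xe xS|HS e eH].
  by apply: (implyP (HS e eH)); exact: meets_intro xe xS.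
by apply/implyP => /meets_witness[x xe xS]; exact: HS eH xe xS.
Qed.

Lemma closed_inC H S : closed_in H S -> closed_in H (~: S).
Proof.
move=> /closed_inP HS; apply/closed_inP => e x eH xe.
rewrite inE => xS; apply/subsetP => y ye; rewrite inE; apply: contra xS => yS.
exact: (subsetP (HS e y eH ye yS)).
Qed.

Lemma closed_in_comp H x : closed_in H (component H x).
Proof.
apply/closed_inP => e y eH ye /bigcapP ycomp.
apply/bigcapsP => S /andP[HS xS].
by move/closed_inP: (HS) => /(_ e y eH ye); apply; apply: ycomp; rewrite HS.
Qed.

Lemma mem_comp H x : x \in component H x.
Proof. by apply/bigcapP => S /andP[]. Qed.

Lemma comp_sub H S x : closed_in H S -> x \in S -> component H x \subset S.
Proof. by move=> HS xS; apply: bigcap_inf; rewrite HS. Qed.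

Lemma comp_eq H x y : y \in component H x -> component H y = component H x.
Proof.
move=> yx; apply/eqP; rewrite eqEsubset comp_sub ?closed_in_comp//=.
apply: comp_sub; first exact: closed_in_comp.
apply: contraLR yx => xy.
have : component H x \subset ~: component H y.
  by apply: comp_sub; rewrite ?inE//; apply: closed_inC; exact: closed_in_comp.
move=> /subsetP /(_ y); rewrite inE mem_comp /= => yx.
by apply/negP => /yx.
Qed.

Lemma edge_sub_comp H e x : e \in H -> x \in e -> e \subset component H x.
Proof.
move=> eH xe; have /closed_inP := closed_in_comp H x.
by move=> /(_ e x eH xe); apply; exact: mem_comp.
Qed.

(** The connectedness of components, in terms of closed sets. *)
Lemma comp_min H x S : closed_in H S -> S != set0 -> S \subset component H x ->
  S = component H x.
Proof.
move=> HS /set0Pn[y yS] Sx; apply/eqP; rewrite eqEsubset Sx /=.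
by rewrite -(comp_eq (subsetP Sx _ yS)); exact: comp_sub.
Qed.

Lemma closed_in_transfer H H' S T :
  touch H S = touch H' S -> T \subset S -> closed_in H T -> closed_in H' T.
Proof.
move=> HH' TS /closed_inP HT; apply/closed_inP => e x eH xe xT.
apply: (HT e x _ xe xT).
have : e \in touch H' S.
  by rewrite inE eH (meets_intro xe (subsetP TS _ xT)).
by rewrite -HH' inE => /andP[].
Qed.

(** Locality of components: what happens off [S] has no influence on the
    components in [S]. *)
Lemma comp_transfer H H' S x : touch H S = touch H' S -> closed_in H S ->
  x \in S -> component H x = component H' x.
Proof.
move=> HH' HS xS; have H'S := closed_in_transfer HH' (subxx S) HS.
apply/eqP; rewrite eqEsubset !comp_sub ?mem_comp//.
  apply: (closed_in_transfer HH'); last exact: closed_in_comp.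
  exact: comp_sub.
apply: (closed_in_transfer (esym HH')); last exact: closed_in_comp.
exact: comp_sub.
Qed.

(** * Cycles and subtrees *)

(** A walk [a, e1, v1, e2, v2, ...] is given by its first vertex and the
    sequence of the pairs [(ei, vi)]. *)
Fixpoint walk a (p : seq ({set V} * V)) : bool :=
  if p is (e, v) :: q then [&& a != v, a \in e, v \in e & walk v q] else true.

Definition walk_end a (p : seq ({set V} * V)) : V := last a (map snd p).

Lemma walk_rcons a p e v : walk a (rcons p (e, v)) =
  walk a p && [&& walk_end a p != v, walk_end a p \in e & v \in e].
Proof.
rewrite /walk_end; elim: p a => [|[f w] p IH] a /=; first by rewrite !andbT.
by rewrite IH !andbA.
Qed.

(** A Berge cycle is a walk from [a] closed by a further edge [e]. That the
    edges are distinct makes all of them appear with a small probability; that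
    consecutive vertices are distinct makes cycles few. Nonconsecutive vertices
    may coincide. *)
Definition berge_cycle H a p e := [&& walk a p, walk_end a p != a,
  walk_end a p \in e, a \in e, uniq (e :: map fst p) & all (mem H) (e :: map fst p)].

Definition acyclic H := forall a p e, ~~ berge_cycle H a p e.

Definition joined E a b := exists p,
  [/\ walk a p, walk_end a p = b, uniq (map fst p) & all (mem E) (map fst p)].

Lemma joined_sub E E' a b : E \subset E' -> joined E a b -> joined E' a b.
Proof.
move=> /subsetP EE' [p [wp pb up pE]]; exists p; split => //.
by apply/allP => e /(allP pE)/EE'.
Qed.

Lemma joined_edge E a b e :
  a != b -> a \in e -> b \in e -> e \in E -> joined E a b.
Proof.
by move=> ab ae be eE; exists [:: (e, b)]; rewrite /= ab ae be; split; rewrite // /mem /= andbT.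
Qed.

Lemma joined_rcons E a b c e : joined E a b -> e \notin E -> b != c ->
  b \in e -> c \in e -> joined (e |: E) a c.
Proof.
move=> [p [wp pb up pE]] eE bc be ce; exists (rcons p (e, c)); split.
- by rewrite walk_rcons wp pb bc be ce.
- by rewrite /walk_end map_rcons last_rcons.
- rewrite map_rcons rcons_uniq up andbT; apply/negP => /(allP pE).
  by rewrite /mem /= (negbTE eE).
- rewrite map_rcons all_rcons /= setU11; apply/allP => f /(allP pE) fE.
  by apply: setU1r.
Qed.

Lemma joined_cons E a b c e : joined E a b -> e \notin E -> c != a ->
  a \in e -> c \in e -> joined (e |: E) c b.
Proof.
move=> [p [wp pb up pE]] eE bc be ce; exists ((e, a) :: p); split.
- by rewrite /= wp bc be ce.
- by [].
- rewrite /= up andbT; apply/negP => /(allP pE).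
  by rewrite /mem /= (negbTE eE).
- rewrite /= setU11; apply/allP => f /(allP pE) fE.
  by apply: setU1r.
Qed.

Lemma joined_cycle H E a b e : E \subset H -> joined E a b -> e \in H ->
  e \notin E -> a != b -> a \in e -> b \in e -> ~ acyclic H.
Proof.
move=> EH [p [wp pb up pE]] eH eE ab ae be acH.
have /negP := acH a p e; apply; rewrite /berge_cycle wp pb eq_sym ab ae be /= up.
rewrite andbT; apply/and3P; split => //; last first.
  by apply/allP => f /(allP pE)/(subsetP EH).
by apply/negP => /(allP pE); rewrite /mem /= (negbTE eE).
Qed.

(** The vertex set and the edge set of a subtree of [H]. Two vertices are joined
    in one direction or the other: a new vertex can be appended at the end of
    a walk or put before its start, so that walks are never reversed. *)
Record subtree d H S E : Prop := Subtree {
  subtree_sub : E \subset H;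
  subtree_inside e : e \in E -> e \subset S;
  subtree_card : #|S| = d * #|E| + 1;
  subtree_joined a b : a \in S -> b \in S -> a != b ->
    joined E a b \/ joined E b a }.

Lemma subtree1 d H x : subtree d H [set x] set0.
Proof.
split; rewrite ?sub0set ?cards1 ?cards0 ?muln0//; first by move=> e; rewrite inE.
by move=> a b; rewrite !inE => /eqP -> /eqP ->; rewrite eqxx.
Qed.

(** In an acyclic hypergraph, the new edge meets the subtree in one vertex, since
    two common vertices would be joined by a walk that the edge closes. It thus
    brings [d] new vertices. *)
Lemma subtree_grow d H S E e : acyclic H -> subtree d H S E -> e \in H ->
  e \notin E -> #|e| = d.+1 -> ~~ [disjoint e & S] ->
  subtree d H (e :|: S) (e |: E).
Proof.
move=> acH tSE eH eE de /meets_witness[z ze zS].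
have [EH ES cS jS] := tSE.
have uz a : a \in e -> a \in S -> a = z.
  move=> ae aS; apply/eqP/negPn/negP => az.
  have [J|J] := jS _ _ aS zS az; first exact: (joined_cycle EH J eH eE az ae ze).
  by rewrite eq_sym in az; exact: (joined_cycle EH J eH eE az ze ae).
have eS : e :&: S = [set z].
  apply/setP => a; rewrite !inE; apply/andP/eqP => [[]|->]; first exact: uz.
  by rewrite ze zS.
split.
- by rewrite subUset sub1set eH.
- move=> f /setU1P[->|fE]; first exact: subsetUl.
  by apply: subset_trans (ES _ fE) _; exact: subsetUr.
- by rewrite cardsU eS cards1 de cS cardsU1 eE; lia.
- suff W a b : a \in S -> b \in e :|: S -> a != b ->
      joined (e |: E) a b \/ joined (e |: E) b a.
    move=> a b aeS beS ab.
    have [aS|aS] := boolP (a \in S); first exact: W.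
    have [bS|bS] := boolP (b \in S).
      by rewrite eq_sym in ab; case: (W b a) => //; [right|left].
    left; apply: (joined_edge (e := e)) => //; last exact: setU11.
      by move: aeS; rewrite inE (negbTE aS) orbF.
    by move: beS; rewrite inE (negbTE bS) orbF.
  move=> aS beS ab; have [bS|bS] := boolP (b \in S).
    have EeE : E \subset e |: E by exact: subsetUr.
    by case: (jS _ _ aS bS ab) => J; [left|right]; exact: joined_sub J.
  have be : b \in e by move: beS; rewrite inE (negbTE bS) orbF.
  have [za|az] := eqVneq a z.
    by left; apply: (joined_edge (e := e)) => //; [rewrite za|exact: setU11].
  have zb : z != b by apply: contraNneq bS => <-.
  case: (jS _ _ aS zS az) => J.
    by left; exact: joined_rcons J eE zb ze be.
  by right; apply: joined_cons J eE _ ze be; rewrite eq_sym.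
Qed.

(** Subtrees grow as long as some unused edge meets them; when there is none,
    their vertex set is closed, hence the whole component. *)
Lemma subtree_exists d H x j : acyclic H -> {in H, forall e, #|e| = d.+1} ->
  j <= #|inside H (component H x)| ->
  exists S E, [/\ subtree d H S E, #|E| = j, x \in S & S \subset component H x].
Proof.
move=> acH dH; elim: j => [_|j IH ltj].
  exists [set x], set0; split; rewrite ?cards0 ?set11 ?sub1set ?mem_comp//.
  exact: subtree1.
have [S [E [tSE cE xS Sx]]] := IH (ltnW ltj).
have [e eH /andP[eE eS]] : exists2 e, e \in H & (e \notin E) && ~~ [disjoint e & S].
  apply/exists_inP; apply: contraLR ltj.
  rewrite negb_exists_in => /forall_inP HE; rewrite -leqNgt -cE.
  have HES e : e \in H -> ~~ [disjoint e & S] -> e \in E.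
    by move=> eH eS; have := HE e eH; rewrite eS andbT negbK.
  have Sc : S = component H x.
    apply: comp_min => //; last by apply/set0Pn; exists x.
    apply/forall_inP => e eH; apply/implyP => /(HES _ eH).
    exact: (subtree_inside tSE).
  apply/subset_leq_card/subsetP => e; rewrite inE -Sc => /andP[eH eS].
  apply: HES => //.
  have /card_gt0P[a ae] : 0 < #|e| by rewrite dH.
  exact: meets_intro ae (subsetP eS _ ae).
exists (e :|: S), (e |: E); split.
- by apply: subtree_grow => //; exact: dH.
- by rewrite cardsU1 eE cE.
- by rewrite inE xS orbT.
- rewrite subUset Sx andbT; have [a ae aS] := meets_witness eS.
  by rewrite -(comp_eq (subsetP Sx _ aS)); exact: edge_sub_comp.
Qed.

Lemma card_comp_acyclic d H x : acyclic H -> {in H, forall e, #|e| = d.+1} ->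
  #|component H x| = d * #|inside H (component H x)| + 1.
Proof.
move=> acH dH; have [S [E [tSE cE xS Sx]]] :=
  subtree_exists (x := x) acH dH (leqnn _).
have EH : E = inside H (component H x).
  apply/eqP; rewrite eqEcard cE leqnn andbT; apply/subsetP => e eE.
  rewrite inE (subsetP (subtree_sub tSE) _ eE).
  exact: subset_trans (subtree_inside tSE eE) Sx.
suff Sc : S = component H x by rewrite -cE -(subtree_card tSE) Sc.
apply: comp_min => //; last by apply/set0Pn; exists x.
apply/closed_inP => e a eH ae aS; apply: (subtree_inside tSE).
rewrite EH inE eH -(comp_eq (subsetP Sx _ aS)); exact: edge_sub_comp.
Qed.

End Components.

(** * Types and Ehrenfeucht-Fraisse games *)

Lemma extend_ord0 T k (x : T) (v : 'I_k -> T) : extend x v ord0 = x.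
Proof. by rewrite /extend unlift_none. Qed.

Lemma extend_lift T k (x : T) (v : 'I_k -> T) i :
  extend x v (lift ord0 i) = v i.
Proof. by rewrite /extend liftK. Qed.

Definition atom_code (d k : nat) : finType :=
  ({ffun 'I_k * 'I_k -> bool} * {ffun {ffun 'I_d.+1 -> 'I_k} -> bool})%type.

(** Codes for the quantifier rank [r] types of [k]-tuples. They form a finite
    type, so that there are finitely many rank [r] types, and codes of tuples
    from different hypergraphs can be compared. *)
Fixpoint type_code (d r k : nat) : finType :=
  if r is r'.+1 then (atom_code d k * {set (type_code d r' k.+1)})%type
  else atom_code d k.

Definition atom_type d (V : finType) (H : {set {set V}}) k (v : 'I_k -> V) :
    atom_code d k :=
  ([ffun ij : 'I_k * 'I_k => v ij.1 == v ij.2],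
   [ffun t : {ffun 'I_d.+1 -> 'I_k} => [set v (t i) | i : 'I_d.+1] \in H]).

Fixpoint rank_type d (V : finType) (H : {set {set V}}) (U : {set V}) r :
    forall k, ('I_k -> V) -> type_code d r k :=
  match r return forall k, ('I_k -> V) -> type_code d r k with
  | 0 => fun k v => atom_type d H v
  | r'.+1 => fun k v =>
      (atom_type d H v, [set rank_type d H U r' (extend x v) | x in U])
  end.

(** The rank [r] type of the subhypergraph induced on [U]. *)
Definition set_type d (V : finType) (H : {set {set V}}) r (U : {set V}) :
  type_code d r 0 := rank_type d H U r (@no_var V).

Lemma atom_type_ext d (V : finType) (H : {set {set V}}) k (v w : 'I_k -> V) :
  v =1 w -> atom_type d H v = atom_type d H w.
Proof.
move=> vw; congr pair; apply/ffunP => t; rewrite !ffunE; first by rewrite !vw.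
suff -> : [set v (t i) | i : 'I_d.+1] = [set w (t i) | i : 'I_d.+1] by [].
by apply: eq_imset => i; rewrite vw.
Qed.

Lemma rank_type_ext d (V : finType) (H : {set {set V}}) U r k (v w : 'I_k -> V) :
  v =1 w -> rank_type d H U r v = rank_type d H U r w.
Proof.
elim: r k v w => [|r IH] k v w vw /=; first exact: atom_type_ext.
congr pair; first exact: atom_type_ext.
apply: eq_imset => x; apply: IH => i; rewrite /extend.
by case: unliftP => // j _; exact: vw.
Qed.

(** Types are invariant under isomorphisms; the identity is also of interest
    here, as [E] and [H] may differ off [U]. *)
Lemma rank_type_inj d (V W : finType) (g : V -> W) (E : {set {set V}})
    (H : {set {set W}}) (U : {set V}) r k (v : 'I_k -> V) :
  injective g ->
  (forall e : {set V}, e \subset U -> (g @: e \in H) = (e \in E)) ->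
  (forall i, v i \in U) ->
  rank_type d H (g @: U) r (g \o v) = rank_type d E U r v.
Proof.
move=> gi gE; have atoms k' (v' : 'I_k' -> V) : (forall i, v' i \in U) ->
    atom_type d H (g \o v') = atom_type d E v'.
  move=> vU; congr pair; apply/ffunP => t; rewrite !ffunE /=; first exact: inj_eq.
  have -> : [set g (v' (t i)) | i : 'I_d.+1] = g @: [set v' (t i) | i : 'I_d.+1].
    by rewrite -imset_comp.
  by apply: gE; apply/subsetP => x /imsetP[i _ ->].
elim: r k v => [|r IH] k v vU /=; first exact: atoms.
congr pair; first exact: atoms.
rewrite -imset_comp; apply: eq_in_imset => x xU /=.
rewrite -IH => [|i]; last by rewrite /extend; case: unliftP.
by apply: rank_type_ext => i; rewrite /extend /=; case: unliftP.
Qed.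

Lemma set_type_inj d (V W : finType) (g : V -> W) (E : {set {set V}})
    (H : {set {set W}}) (U : {set V}) r :
  injective g -> (forall e : {set V}, e \subset U -> (g @: e \in H) = (e \in E)) ->
  set_type d H r (g @: U) = set_type d E r U.
Proof.
move=> gi gE; rewrite /set_type -(@rank_type_inj d _ _ g E H U r 0) //.
- by apply: rank_type_ext => -[].
- by case.
Qed.

Lemma set_type_local d (V : finType) (H E : {set {set V}}) (U : {set V}) r :
  inside H U = inside E U -> set_type d H r U = set_type d E r U.
Proof.
move=> HE; have := @set_type_inj d V V id E H U r (fun _ _ => id).
rewrite imset_id; apply => e eU; rewrite imset_id.
by move/setP/(_ e): HE; rewrite !inE eU !andbT.
Qed.

Section BackAndForth.
Variable d : nat.

Definition partial_iso (V W : finType) (H : {set {set V}}) (H' : {set {set W}})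
    (s : seq (V * W)) :=
  (forall p q, p \in s -> q \in s -> (p.1 == q.1) = (p.2 == q.2)) /\
  (forall t : 'I_d.+1 -> V * W, (forall i, t i \in s) ->
    ([set (t i).1 | i : 'I_d.+1] \in H) = ([set (t i).2 | i : 'I_d.+1] \in H')).

(** Duplicator wins the [r]-round Ehrenfeucht-Fraisse game in which new
    elements are taken from [U] and [U'], from the position [s]. *)
Fixpoint back_forth (V W : finType) (H : {set {set V}}) (H' : {set {set W}})
    (U : {set V}) (U' : {set W}) r (s : seq (V * W)) : Prop :=
  partial_iso H H' s /\
  if r is r'.+1 then
    (forall x, x \in U -> exists2 y, y \in U' &
      back_forth H H' U U' r' ((x, y) :: s)) /\
    (forall y, y \in U' -> exists2 x, x \in U &
      back_forth H H' U U' r' ((x, y) :: s))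
  else True.

Definition swap_seq (V W : Type) (s : seq (V * W)) : seq (W * V) :=
  [seq (p.2, p.1) | p <- s].

Lemma swap_seqK (V W : Type) (s : seq (V * W)) : swap_seq (swap_seq s) = s.
Proof. by rewrite /swap_seq -map_comp -[RHS]map_id; apply: eq_map => -[]. Qed.

Lemma mem_swap_seq (V W : finType) (s : seq (V * W)) p :
  (p \in swap_seq s) = ((p.2, p.1) \in s).
Proof.
apply/mapP/idP => [[[x y] ps -> //]|ps]; exists (p.2, p.1) => //.
by case: p ps.
Qed.

Section TwoHypergraphs.
Variables (V W : finType) (H : {set {set V}}) (H' : {set {set W}}).
Implicit Types (s : seq (V * W)) (U : {set V}) (T : {set W}).

Lemma partial_iso_sub s s' :
  {subset s' <= s} -> partial_iso H H' s -> partial_iso H H' s'.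
Proof.
move=> ss [s1 s2]; split=> [p q /ss ps /ss qs|t ts]; first exact: s1.
by apply: s2 => i; exact/ss/ts.
Qed.

Lemma back_forth_iso U T r s : back_forth H H' U T r s -> partial_iso H H' s.
Proof. by case: r => [|r] []. Qed.

Lemma back_forth_sub U T r s s' : {subset s' <= s} ->
  back_forth H H' U T r s -> back_forth H H' U T r s'.
Proof.
elim: r s s' => [|r IH] s s' ss /= [s1 s2]; split=> //.
- exact: partial_iso_sub s1.
- exact: partial_iso_sub s1.
have cs x y : {subset (x, y) :: s' <= (x, y) :: s}.
  by move=> p; rewrite !inE => /predU1P[->|/ss ->]; rewrite ?eqxx ?orbT.
case: s2 => forth back; split=> [x /forth[y yU bf]|y /back[x xU bf]].
  by exists y => //; exact: IH bf.
by exists x => //; exact: IH bf.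
Qed.

Lemma back_forth_pred U T r s :
  back_forth H H' U T r.+1 s -> back_forth H H' U T r s.
Proof.
elim: r s => [|r IH] s; first by case.
case=> s1 [forth back]; split=> //; split.
  by move=> x /forth[y yU bf]; exists y => //; exact: IH.
by move=> y /back[x xU bf]; exists x => //; exact: IH.
Qed.

Lemma atom_type_iso k (v : 'I_k -> V) (w : 'I_k -> W) :
  atom_type d H v = atom_type d H' w ->
  partial_iso H H' [seq (v i, w i) | i <- enum 'I_k].
Proof.
move=> [/ffunP e1 /ffunP e2]; split.
  move=> _ _ /mapP[i _ ->] /mapP[j _ ->] /=.
  by have := e1 (i, j); rewrite !ffunE.
move=> t ts; have /fin_all_exists[u ut] :
    forall i, exists j, t i = (v j, w j).
  by move=> i; have /mapP[j _ tj] := ts i; exists j.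
have := e2 [ffun i => u i]; rewrite !ffunE /=.
have -> : [set (t i).1 | i : 'I_d.+1] =
    [set v ([ffun i => u i] i) | i : 'I_d.+1].
  by apply: eq_imset => i; rewrite ut ffunE.
have -> : [set (t i).2 | i : 'I_d.+1] =
    [set w ([ffun i => u i] i) | i : 'I_d.+1].
  by apply: eq_imset => i; rewrite ut ffunE.
by [].
Qed.

Lemma rank_type_back_forth U T r k (v : 'I_k -> V) (w : 'I_k -> W) :
  rank_type d H U r v = rank_type d H' T r w ->
  back_forth H H' U T r [seq (v i, w i) | i <- enum 'I_k].
Proof.
elim: r k v w => [|r IH] k v w /=; first by split=> //; exact: atom_type_iso.
move=> e; have /atom_type_iso ai := congr1 fst e; have /setP eU := congr1 snd e.
split=> // {e}.
have step x y : rank_type d H U r (extend x v) = rank_type d H' T r (extend y w) ->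
    back_forth H H' U T r ((x, y) :: [seq (v i, w i) | i <- enum 'I_k]).
  move/IH; rewrite enum_ordSl /= !extend_ord0 -map_comp; congr back_forth.
  by congr cons; apply: eq_map => i; rewrite /= !extend_lift.
split=> [x xU|y yU].
  have := eU (rank_type d H U r (extend x v)); rewrite imset_f// => /esym.
  by case/imsetP => y yU /step bf; exists y.
have := eU (rank_type d H' T r (extend y w)); rewrite [in RHS]imset_f//.
by case/imsetP => x xU /esym /step bf; exists x.
Qed.

Lemma set_type_back_forth U T r :
  set_type d H r U = set_type d H' r T -> back_forth H H' U T r [::].
Proof. by move/rank_type_back_forth; apply: back_forth_sub. Qed.

End TwoHypergraphs.

Lemma partial_iso_swap (V W : finType) (H : {set {set V}}) (H' : {set {set W}}) s :
  partial_iso H H' s -> partial_iso H' H (swap_seq s).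
Proof.
move=> [s1 s2]; split=> [p q|t ts].
  by rewrite !mem_swap_seq => ps qs; rewrite -(s1 _ _ ps qs).
have := s2 (fun i => ((t i).2, (t i).1)); rewrite /= => -> // i.
by have := ts i; rewrite mem_swap_seq.
Qed.

Lemma back_forth_swap (V W : finType) (H : {set {set V}}) (H' : {set {set W}})
    U U' r s :
  back_forth H H' U U' r s -> back_forth H' H U' U r (swap_seq s).
Proof.
elim: r s => [|r IH] s [/partial_iso_swap ps]; first by split.
move=> [forth back]; split=> //; split.
  by move=> y /back[x xU /IH bf]; exists x.
by move=> x /forth[y yU /IH bf]; exists y.
Qed.

Fixpoint quantifier_rank k (phi : formula d k) : nat :=
  match phi with
  | FFalse _ | FEq _ _ _ | FSigma _ _ => 0
  | FNot _ f => quantifier_rank f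
  | FAnd _ f g | FOr _ f g | FImp _ f g =>
      maxn (quantifier_rank f) (quantifier_rank g)
  | FForall _ f | FExists _ f => (quantifier_rank f).+1
  end.

Lemma back_forth_sat n n' (H : {set {set 'I_n}}) (H' : {set {set 'I_n'}})
    k (phi : formula d k) r s (v : 'I_k -> 'I_n) (w : 'I_k -> 'I_n') :
  back_forth H H' [set: 'I_n] [set: 'I_n'] r s -> quantifier_rank phi <= r ->
  (forall i, (v i, w i) \in s) -> sat H phi v = sat H' phi w.
Proof.
elim: phi r s v w => {k} //=.
- move=> k i j r s v w /back_forth_iso[s1 _] _ vs.
  exact: s1 (vs i) (vs j).
- move=> k t r s v w /back_forth_iso[_ s2] _ vs.
  exact: (s2 (fun i => (v (t i), w (t i)))).
- by move=> k f IH r s v w bf fr vs; congr negb; exact: IH bf fr vs.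
- move=> k f IHf g IHg r s v w bf; rewrite geq_max => /andP[fr gr] vs.
  by congr andb; [exact: IHf bf fr vs|exact: IHg bf gr vs].
- move=> k f IHf g IHg r s v w bf; rewrite geq_max => /andP[fr gr] vs.
  by congr orb; [exact: IHf bf fr vs|exact: IHg bf gr vs].
- move=> k f IHf g IHg r s v w bf; rewrite geq_max => /andP[fr gr] vs.
  by congr implb; [exact: IHf bf fr vs|exact: IHg bf gr vs].
- move=> k f IH [//|r] s v w [_ [forth back]] fr vs.
  have IHe x y : back_forth H H' setT setT r ((x, y) :: s) ->
      sat H f (extend x v) = sat H' f (extend y w).
    move=> bf; apply: IH bf fr _ => i; rewrite /extend.
    by case: unliftP => [j _|_]; rewrite inE ?eqxx ?vs ?orbT.
  apply/forallP/forallP => satf.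
    by move=> y; have [x _ /IHe <-] := back y (in_setT _).
  by move=> x; have [y _ /IHe ->] := forth x (in_setT _).
- move=> k f IH [//|r] s v w [_ [forth back]] fr vs.
  have IHe x y : back_forth H H' setT setT r ((x, y) :: s) ->
      sat H f (extend x v) = sat H' f (extend y w).
    move=> bf; apply: IH bf fr _ => i; rewrite /extend.
    by case: unliftP => [j _|_]; rewrite inE ?eqxx ?vs ?orbT.
  apply/existsP/existsP => -[].
    by move=> x satx; have [y _ /IHe e] := forth x (in_setT _); exists y; rewrite -e.
  by move=> y saty; have [x _ /IHe e] := back y (in_setT _); exists x; rewrite e.
Qed.

(** * Composition of winning strategies over unions of components *)

(** Components of [H] off the blocks [B] can still be imitated by components of
    [H'] off the blocks [B']. As each move uses up at most one of them, [r]
    of them suffice for [r] moves. *)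
Definition spare (V W : finType) (H : {set {set V}}) (H' : {set {set W}}) r
    (B : seq {set V}) (B' : seq {set W}) :=
  forall x, (forall b, b \in B -> x \notin b) ->
  exists2 S : {set {set W}}, r <= #|S| & forall C, C \in S ->
    (exists2 y, C = component H' y & forall b, b \in B' -> y \notin b) /\
    back_forth H H' (component H x) C r [::].

(** The invariant of Duplicator's strategy: the played elements lie in matched
    blocks, on each of which the position is winning, and enough components
    off these blocks are left to answer the remaining [r] moves. *)
Definition block_position (V W : finType) (H : {set {set V}}) (H' : {set {set W}})
    r (s : seq (V * W)) := exists B : seq ({set V} * {set W}),
  [/\ forall b, b \in B -> closed_in H b.1 /\ closed_in H' b.2,
      forall b c, b \in B -> c \in B ->
        b = c \/ [disjoint b.1 & c.1] /\ [disjoint b.2 & c.2],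
      forall p, p \in s -> exists2 b, b \in B & (p.1 \in b.1) && (p.2 \in b.2),
      forall b, b \in B -> back_forth H H' b.1 b.2 r
        [seq p <- s | (p.1 \in b.1) && (p.2 \in b.2)] &
      spare H H' r (map fst B) (map snd B) /\ spare H' H r (map snd B) (map fst B)].

Lemma block_position_swap (V W : finType) (H : {set {set V}})
    (H' : {set {set W}}) r s :
  block_position H H' r s -> block_position H' H r (swap_seq s).
Proof.
move=> [B [cB dB pB bB [sp sp']]]; exists (swap_seq B); split.
- by move=> b; rewrite mem_swap_seq => /cB[].
- move=> b c; rewrite !mem_swap_seq => bB' cB'.
  case: (dB _ _ bB' cB') => [[e1 e2]|[/= d1 d2]]; last by right.
  by left; case: b c e1 e2 {bB' cB'} => ? ? [? ?] /= -> ->.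
- move=> p; rewrite mem_swap_seq => /pB[b bB' /= /andP[b1 b2]].
  by exists (b.2, b.1); rewrite ?mem_swap_seq /= ?b2 -?surjective_pairing.
- move=> b; rewrite mem_swap_seq => /bB /back_forth_swap.
  apply: back_forth_sub => p; rewrite !mem_filter !mem_swap_seq mem_filter /=.
  by rewrite [(_ \in b.2) && _]andbC.
- by rewrite /swap_seq -!map_comp.
Qed.

Section Strategy.
Variables (V W : finType) (H : {set {set V}}) (H' : {set {set W}}).
Implicit Types (s : seq (V * W)).

Lemma block_position_iso r s : block_position H H' r s -> partial_iso H H' s.
Proof.
move=> [B [cB dB pB bB _]].
split.
  move=> p q ps qs; have [b bb /andP[p1 p2]] := pB _ ps.
  have [c cc /andP[q1 q2]] := pB _ qs.
  case: (dB _ _ bb cc) => [e|[d1 d2]].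
    subst c; have [iso _] := back_forth_iso (bB _ bb).
    by apply: iso; rewrite mem_filter ?p1 ?p2 ?q1 ?q2.
  transitivity false; [|apply/esym]; apply/negP => /eqP e.
    by have := disjointFr d1 p1; rewrite e q1.
  by have := disjointFr d2 p2; rewrite e q2.
have im (X : finType) (f : 'I_d.+1 -> X) j : f j \in [set f i | i : 'I_d.+1].
  by apply/imsetP; exists j.
move=> t ts; have [b bb /andP[p1 p2]] := pB _ (ts ord0).
have [cl cl'] := cB _ bb.
have [/forallP all_b|] := boolP [forall i, ((t i).1 \in b.1) && ((t i).2 \in b.2)].
  have [_ iso] := back_forth_iso (bB _ bb); apply: iso => i.
  by rewrite mem_filter all_b ts.
rewrite negb_forall => /existsP[i ib].
have [c cc /andP[q1 q2]] := pB _ (ts i).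
case: (dB _ _ bb cc) => [e|[d1 d2]]; first by rewrite e q1 q2 in ib.
transitivity false; [|apply/esym]; apply/negP => tH.
  have sub := closed_inP _ _ cl _ _ tH (im _ (fun i => (t i).1) ord0) p1.
  by have := subsetP sub _ (im _ _ i); rewrite (disjointFl d1 q1).
have sub := closed_inP _ _ cl' _ _ tH (im _ (fun i => (t i).2) ord0) p2.
by have := subsetP sub _ (im _ _ i); rewrite (disjointFl d2 q2).
Qed.

Lemma spare_pred r B B' : spare H H' r.+1 B B' -> spare H H' r B B'.
Proof.
move=> sp x /sp[S rS HS]; exists S; first exact: ltnW.
by move=> C /HS[? ?]; split=> //; exact: back_forth_pred.
Qed.

Lemma spare_cons r b B y B' :
  spare H H' r.+1 B B' -> spare H H' r (b :: B) (component H' y :: B').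
Proof.
move=> sp x xB; have [|S rS HS] := sp x.
  by move=> c cB; apply: xB; rewrite inE cB orbT.
exists (S :\ component H' y).
  rewrite -ltnS (leq_trans rS)// (cardsD1 (component H' y)) -add1n.
  by rewrite leq_add2r leq_b1.
move=> C /setD1P[Cy /HS[[z Cz zB'] bf]]; split; last exact: back_forth_pred.
exists z => // c; rewrite inE => /predU1P[->|/zB'//].
by apply: contra Cy => /comp_eq zy; rewrite Cz zy.
Qed.

Lemma disjoint_comp (U : finType) (E : {set {set U}}) S x :
  closed_in E S -> x \notin S -> [disjoint component E x & S].
Proof.
move=> ES xS; rewrite disjoints_subset; apply: comp_sub; last by rewrite inE.
exact: closed_inC.
Qed.

End Strategy.

Lemma block_position_forth (V W : finType) (H : {set {set V}})
    (H' : {set {set W}}) r s : block_position H H' r.+1 s ->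
  forall x, exists y, block_position H H' r ((x, y) :: s).
Proof.
move=> [B [cB dB pB bB [sp sp']]] x.
have [/hasP[b bb xb]|/hasPn noB] := boolP (has (fun b : {set V} * {set W} => x \in b.1) B).
  (* The move falls in a matched block: answer inside the matching block. *)
  have [_ [forth _]] := bB _ bb; have [y yb bf] := forth x xb.
  exists y, B; split=> //.
  - by move=> p /predU1P[->|/pB//]; exists b; rewrite ?xb.
  - move=> c cc; case: (dB _ _ bb cc) => [<- /=|[d1 d2]].
      by rewrite xb yb; exact: bf.
    by rewrite /= (disjointFr d1 xb) /=; apply: back_forth_pred; exact: bB.
  - by split; exact: spare_pred.
(* Otherwise match the component of the move with a spare component. *)
have xB b : b \in map fst B -> x \notin b.
  by case/mapP => c cc ->; exact: noB.
have [S rS HS] := sp x xB.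
have /card_gt0P[C CS] : 0 < #|S| by exact: leq_trans rS.
have [[y0 Cy y0B] bfC] := HS C CS.
have [_ [forth _]] := bfC; have [y yC bf] := forth x (mem_comp _ _).
exists y, ((component H x, C) :: B).
have dj b : b \in B -> [disjoint component H x & b.1] /\ [disjoint C & b.2].
  move=> bb; have [cl cl'] := cB _ bb; split.
    by apply: disjoint_comp => //; exact: noB.
  by rewrite Cy; apply: disjoint_comp => //; apply: y0B; exact: map_f.
split.
- move=> b /predU1P[->|/cB//] /=.
  by rewrite Cy; split; exact: closed_in_comp.
- move=> b c /predU1P[->|bb] /predU1P[->|cc]; first by left.
  + by right; exact: dj.
  + by right; have [d1 d2] := dj _ bb; split; rewrite disjoint_sym.
  + exact: dB.
- move=> p /predU1P[->|/pB[b bb pb]].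
    by exists (component H x, C); rewrite ?mem_head //= mem_comp.
  by exists b => //; rewrite inE bb orbT.
- move=> b /predU1P[->|bb].
    apply: back_forth_sub bf => p; rewrite mem_filter /= inE.
    case/andP => /andP[p1 p2] /predU1P[->|ps]; first exact: mem_head.
    have [c cc /andP[c1 _]] := pB _ ps.
    by have [/disjointFr/(_ p1)] := dj _ cc; rewrite c1.
  by rewrite /= (negbTE (noB _ bb)) /=; apply: back_forth_pred; exact: bB.
- rewrite /= {1}Cy; split; first exact: spare_cons.
  exact: spare_cons.
Qed.

Lemma block_position_back_forth (V W : finType) (H : {set {set V}})
    (H' : {set {set W}}) r s :
  block_position H H' r s -> back_forth H H' [set: V] [set: W] r s.
Proof.
elim: r s => [|r IH] s pos; first by split=> //; exact: block_position_iso pos.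
split; first exact: block_position_iso pos.
split=> [x _|y _].
  by have [y /IH bf] := block_position_forth pos x; exists y.
have [x /block_position_swap] := block_position_forth (block_position_swap pos) y.
by rewrite /= swap_seqK => /IH bf; exists x.
Qed.

(** The situation in which the components off [Z] and [Z'] cannot be told apart in
    [r] rounds, although their numbers may differ. *)
Definition rich (V W : finType) (H : {set {set V}}) (H' : {set {set W}}) r
    (Z : {set V}) (Z' : {set W}) :=
  forall x, x \notin Z ->
  exists2 S : {set {set W}}, r <= #|S| & forall C, C \in S ->
    (exists2 y, C = component H' y & y \notin Z') /\
    set_type d H' r C = set_type d H r (component H x).

(** Duplicator matches [Z] with [Z'], and each newly visited component with an
    unused one of the same type. *)
Lemma rich_sat n n' (H : {set {set 'I_n}}) (H' : {set {set 'I_n'}}) r Z Z'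
    (phi : sentence d) :
  closed_in H Z -> closed_in H' Z' ->
  set_type d H r Z = set_type d H' r Z' ->
  rich H H' r Z Z' -> rich H' H r Z' Z ->
  quantifier_rank phi <= r -> models H phi = models H' phi.
Proof.
move=> HZ HZ' ZZ' HH' H'H phir; apply: (back_forth_sat (r := r) (s := [::])) => //; last by case.
apply: block_position_back_forth; exists [:: (Z, Z')]; split=> //.
- by move=> b /predU1P[->|//].
- by move=> b c /predU1P[->|//] /predU1P[->|//]; left.
- by move=> b /predU1P[->|//] /=; exact: set_type_back_forth.
- have rs (V W : finType) (A : {set {set V}}) (B : {set {set W}}) X Y :
      rich A B r X Y -> spare A B r [:: X] [:: Y].
    move=> AB x xX; have [|S rS HS] := AB x; first exact: xX (mem_head _ _).
    exists S => // C /HS[[y Cy yY] e]; split.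
      by exists y => // b /predU1P[->|//].
    exact/set_type_back_forth/esym.
  by split; exact: rs.
Qed.

End BackAndForth.

(** * Random subsets *)

Local Open Scope ring_scope.

Section RandomSubset.
Variables (R : realType) (E : finType) (q : R).
Implicit Types (A B C H : {set E}) (f g : {set E} -> R).

Definition subset_mass C H : R := \prod_(e in C) (if e \in H then q else 1 - q).

(** The expectation of [f] on a random subset of [C] that contains each
    element independently with probability [q]. *)
Definition expect C f : R := \sum_(H : {set E} | H \subset C) subset_mass C H * f H.

Definition prob C (P : pred {set E}) : R := expect C (fun H => (P H)%:R).

Lemma eq_expect C f g : (forall H, H \subset C -> f H = g H) ->
  expect C f = expect C g.
Proof. by move=> fg; apply: eq_bigr => H HC; rewrite fg. Qed.

Lemma expectD C f g : expect C (fun H => f H + g H) = expect C f + expect C g.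
Proof. by rewrite -big_split; apply: eq_bigr => H _; rewrite mulrDr. Qed.

Lemma expectZ C a f : expect C (fun H => a * f H) = a * expect C f.
Proof. by rewrite mulr_sumr; apply: eq_bigr => H _; rewrite mulrCA. Qed.

Lemma expectB C f g : expect C (fun H => f H - g H) = expect C f - expect C g.
Proof. by rewrite -sumrB; apply: eq_bigr => H _; rewrite mulrBr. Qed.

Lemma expect_sum C (I : Type) (r : seq I) (P : pred I) (f : I -> {set E} -> R) :
  expect C (fun H => \sum_(i <- r | P i) f i H) = \sum_(i <- r | P i) expect C (f i).
Proof.
rewrite exchange_big; apply: eq_bigr => H _ /=; exact: mulr_sumr.
Qed.

Lemma expect_split B C f : B \subset C ->
  expect C f = \sum_(H1 : {set E} | H1 \subset B)
    subset_mass B H1 * expect (C :\: B) (fun H2 => f (H1 :|: H2)).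
Proof.
move=> BC; rewrite {1}/expect (reindex_onto (fun K : {set E} * {set E} => K.1 :|: K.2)
    (fun H => (H :&: B, H :\: B))) /=; last by move=> H _; rewrite setID.
under [RHS]eq_bigr do rewrite mulr_sumr.
rewrite pair_big_dep /=; apply: eq_big => [[H1 H2]|[H1 H2]] /=.
  apply/andP/andP => [[HC /eqP[e1 e2]]|[H1B H2C]].
    by split; [rewrite -e1 subsetIr|rewrite -e2 setSD].
  have H1' : H1 :\: B = set0 by apply/eqP; rewrite setD_eq0.
  have /setDidPl H2' : [disjoint H2 & B].
    by rewrite disjoints_subset; move: H2C; rewrite setDE subsetI => /andP[].
  have H2'' : H2 :&: B = set0.
    by apply/eqP; rewrite setI_eq0 disjoints_subset; move: H2C; rewrite setDE subsetI => /andP[].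
  rewrite setIUl setDUl H1' H2' H2'' (setIidPl H1B) setU0 set0U eqxx; split=> //.
  by rewrite subUset (subset_trans H1B BC) (subset_trans H2C (subsetDl _ _)).
move=> /andP[_ /eqP[e1 e2]]; rewrite mulrA; congr (_ * _).
rewrite /subset_mass (big_setID B) /= (setIidPr BC); congr (_ * _).
  by apply: eq_bigr => e eB; rewrite -{2}e1 !inE eB andbT.
by apply: eq_bigr => e; rewrite inE => /andP[eB _]; rewrite -{2}e2 !inE (negbTE eB).
Qed.

Lemma subset_mass_total C : \sum_(H : {set E} | H \subset C) subset_mass C H = 1.
Proof.
pose F e := if e \in C then q else 0.
pose G e := if e \in C then 1 - q else 1.
transitivity (\prod_e (F e + G e)); last first.
  by rewrite big1// => e _; rewrite /F /G; case: ifP; lra.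
rewrite bigA_distr [RHS](bigID (fun H : {set E} => H \subset C)) /=.
rewrite [X in _ = _ + X]big1 ?addr0 => [|H HC].
  apply: eq_bigr => H HC; rewrite /subset_mass big_mkcond; apply: eq_bigr => e _.
  rewrite /F /G; case: (boolP (e \in H)) => [eH|_]; first by rewrite (subsetP HC).
  by case: ifP.
have /subsetPn[e eH eC] := HC.
by rewrite (bigD1 e)//= eH /F (negbTE eC) mul0r.
Qed.

Lemma expect_cst C a : expect C (fun=> a) = a.
Proof. by rewrite /expect -mulr_suml subset_mass_total mul1r. Qed.

Lemma subset_mass_block A B : A \subset B ->
  subset_mass B A = q ^+ #|A| * (1 - q) ^+ #|B :\: A|.
Proof.
move=> AB; rewrite /subset_mass (big_setID A) /= (setIidPr AB); congr (_ * _).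
  by rewrite (eq_bigr (fun=> q)) ?prodr_const// => e ->.
rewrite (eq_bigr (fun=> 1 - q)) ?prodr_const// => e.
by rewrite inE => /andP[/negbTE ->].
Qed.

(** What the random subset looks like on [B] is independent of what it looks
    like off [B]. *)
Lemma expect_block A B C f : A \subset B -> B \subset C ->
  expect C (fun H => (H :&: B == A)%:R * f (H :\: B)) =
  q ^+ #|A| * (1 - q) ^+ #|B :\: A| * expect C (fun H => f (H :\: B)).
Proof.
move=> AB BC; rewrite !(expect_split _ BC).
have E12 H1 H2 : H1 \subset B -> H2 \subset C :\: B ->
    (H1 :|: H2) :&: B = H1 /\ (H1 :|: H2) :\: B = H2.
  move=> H1B H2C; have H2B : [disjoint H2 & B].
    by rewrite disjoints_subset; move: H2C; rewrite setDE subsetI => /andP[].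
  rewrite setIUl setDUl (setIidPl H1B) (setDidPl H2B).
  have -> : H2 :&: B = set0 by apply/eqP; rewrite setI_eq0.
  have -> : H1 :\: B = set0 by apply/eqP; rewrite setD_eq0.
  by rewrite setU0 set0U.
rewrite (bigD1 A)//= [X in _ + X]big1 ?addr0 => [|H1 /andP[H1B /negbTE H1A]].
  rewrite subset_mass_block// -!mulrA; congr (_ * (_ * _)).
  transitivity (expect (C :\: B) f).
    by apply: eq_expect => H2 H2C; have [-> ->] := E12 _ _ AB H2C; rewrite eqxx mul1r.
  rewrite -[LHS]mul1r -(subset_mass_total B) mulr_suml; apply: eq_bigr => H1 H1B.
  by congr (_ * _); apply: eq_expect => H2 H2C; have [_ ->] := E12 _ _ H1B H2C.
rewrite (_ : expect _ _ = 0) ?mulr0//.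
rewrite -[RHS](expect_cst (C :\: B) 0); apply: eq_expect => H2 H2C.
by have [-> _] := E12 _ _ H1B H2C; rewrite H1A mul0r.
Qed.

Lemma prob_block A B C : A \subset B -> B \subset C ->
  prob C (fun H => H :&: B == A) = q ^+ #|A| * (1 - q) ^+ #|B :\: A|.
Proof.
move=> AB BC; have := expect_block (fun=> 1) AB BC.
rewrite expect_cst mulr1 => <-.
by apply: eq_expect => H _; rewrite mulr1.
Qed.

Lemma prob_sub A C : A \subset C -> prob C (fun H => A \subset H) = q ^+ #|A|.
Proof.
move=> AC; have := prob_block (subxx A) AC.
rewrite setDv cards0 expr0 mulr1 => <-; apply: eq_expect => H _.
by congr (_%:R); rewrite (sameP setIidPr eqP).
Qed.

Hypothesis q01 : 0 <= q <= 1.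

Lemma subset_mass_ge0 C H : 0 <= subset_mass C H.
Proof.
have /andP[q0 q1] := q01; apply: prodr_ge0 => e _.
by case: ifP => // _; rewrite subr_ge0.
Qed.

Lemma le_expect C f g : (forall H, H \subset C -> f H <= g H) ->
  expect C f <= expect C g.
Proof.
move=> fg; apply: ler_sum => H HC; apply: ler_wpM2l; last exact: fg.
exact: subset_mass_ge0.
Qed.

Lemma expect_ge0 C f : (forall H, H \subset C -> 0 <= f H) -> 0 <= expect C f.
Proof. by move=> f0; rewrite -(expect_cst C 0); exact: le_expect. Qed.

Lemma prob_ge0 C P : 0 <= prob C P.
Proof. by apply: expect_ge0. Qed.

Lemma le_prob C (P Q : pred {set E}) :
  (forall H, H \subset C -> P H -> Q H) -> prob C P <= prob C Q.
Proof.
move=> PQ; apply: le_expect => H HC; rewrite ler_nat.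
by have := PQ H HC; case: (P H) => // ->.
Qed.

Lemma prob_le1 C P : prob C P <= 1.
Proof.
by rewrite -(expect_cst C 1); apply: le_expect => H _; rewrite lern1 leq_b1.
Qed.

Lemma expect_dist C f g : `|expect C f - expect C g| <= expect C (fun H => `|f H - g H|).
Proof.
rewrite -expectB; apply: le_trans (ler_norm_sum _ _ _) _.
by apply: ler_sum => H _; rewrite normrM ger0_norm ?subset_mass_ge0.
Qed.

Lemma prob_dist C (P P' Q : pred {set E}) :
  (forall H, H \subset C -> ~~ Q H -> P H = P' H) ->
  `|prob C P - prob C P'| <= prob C Q.
Proof.
move=> PP'; apply: le_trans (expect_dist _ _ _) _; apply: le_expect => H HC.
have := PP' H HC; case: (Q H) => [_|->//]; last by rewrite subrr normr0.
by case: (P H); case: (P' H); rewrite ?subrr ?normr0 ?subr0 ?sub0r ?normrN ?normr1.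
Qed.

Lemma prob_or C (P Q : pred {set E}) :
  prob C (fun H => P H || Q H) <= prob C P + prob C Q.
Proof.
rewrite -expectD; apply: le_expect => H _.
by case: (P H); case: (Q H); rewrite ?addr0 ?add0r ?lerDl ?ler01.
Qed.

Lemma prob_union_bound C (I : Type) (r : seq I) (P : I -> pred {set E}) :
  prob C (fun H => has (P^~ H) r) <= \sum_(i <- r) prob C (P i).
Proof.
rewrite -expect_sum; apply: le_expect => H _.
elim: r => [|i r IH] /=; first by rewrite big_nil.
rewrite big_cons; case: (P i H) => /=; last by rewrite add0r.
by rewrite lerDl sumr_ge0.
Qed.

End RandomSubset.

(** * Sparse random hypergraphs have no cycles *)

Lemma bin_leq_exp n m : ('C(n, m) <= n ^ m)%N.
Proof.
apply: (@leq_trans (n ^_ m)); first by rewrite -bin_ffact leq_pmulr// fact_gt0.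
elim: m n => [|m IH] [|n]; rewrite ?ffactn0 ?ffact0n//.
rewrite ffactSS expnS leq_mul2l /=; apply: leq_trans (IH _) _.
by case: m {IH} => [|m]; rewrite ?expn0 ?leq_exp2r.
Qed.

Lemma card_supersets (T : finType) (B : {set T}) m :
  (#|[set e : {set T} | (#|e| == m + #|B|) && (B \subset e)]| <= #|T| ^ m)%N.
Proof.
apply: leq_trans (bin_leq_exp _ _); rewrite -card_draws.
set P := [set e | _]; rewrite -(@card_in_imset _ _ (fun e => e :\: B) P).
  apply/subset_leq_card/subsetP => _ /imsetP[e + ->]; rewrite !inE.
  by case/andP => /eqP ce Be; rewrite cardsD (setIidPr Be) ce addnK.
move=> e f; rewrite !inE => /andP[_ Be] /andP[_ Bf] ef.
by rewrite -(setID e B) -(setID f B) ef (setIidPr Be) (setIidPr Bf).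
Qed.

Lemma size_flatten_leq (T : Type) (I : eqType) (r : seq I) (F : I -> seq T) k :
  (forall i, i \in r -> (size (F i) <= k)%N) ->
  (size (flatten (map F r)) <= size r * k)%N.
Proof.
elim: r => //= i r IH Fk; rewrite size_cat mulSn leq_add ?Fk ?mem_head//.
by apply: IH => j jr; apply: Fk; rewrite inE jr orbT.
Qed.

Section SparseHypergraphs.
Variables (d n : nat).
Local Notation V := 'I_n.
Local Notation PE := (potential_edges d n).

Lemma leq_card_bigcup (T I : finType) (P : pred I) (F : I -> {set T}) :
  (#|\bigcup_(i | P i) F i| <= \sum_(i | P i) #|F i|)%N.
Proof.
elim/big_rec2: _ => [|i m A _ IH]; first by rewrite cards0.
by apply: leq_trans (leq_card_setU _ _) _; rewrite leq_add2l.
Qed.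

Lemma card_touch (U : {set V}) : (#|touch PE U| <= #|U| * n ^ d)%N.
Proof.
pose through x := [set e : {set V} | (#|e| == d + #|[set x]|)%N && ([set x] \subset e)].
have sub : touch PE U \subset \bigcup_(x in U) through x.
  apply/subsetP => e; rewrite !inE => /andP[de /meets_witness[x xe xU]].
  by apply/bigcupP; exists x => //; rewrite inE cards1 addn1 de sub1set.
apply: leq_trans (subset_leq_card sub) _; apply: leq_trans (leq_card_bigcup _ _) _.
rewrite -sum_nat_const; apply: leq_sum => x _.
by have := card_supersets [set x] d; rewrite card_ord.
Qed.

(** The walks with [m] steps from [a] are listed in order to be counted: a step
    goes to one of at most [n] vertices, and there are at most [n ^ d.-1] edges
    through two distinct vertices, hence at most [n ^ d] possibilities. *)
Fixpoint walks m (a : V) : seq (seq ({set V} * V)) :=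
  if m is m'.+1 then
    flatten [seq flatten [seq [seq (ev, v) :: w | w <- walks m' v]
      | ev <- enum [set e in PE | [set a; v] \subset e]] | v <- enum [set~ a]]
  else [:: [::]].

Lemma mem_walks a p : walk a p -> all (mem PE) (map fst p) ->
  p \in walks (size p) a.
Proof.
elim: p a => [|[e v] p IH] a //= /and4P[av ae ve wp] /andP[eE pE].
apply/flattenP; eexists; first by apply: (map_f _ (x := v)); rewrite mem_enum !inE eq_sym.
apply/flattenP; eexists.
  by apply: (map_f _ (x := e)); rewrite mem_enum inE eE subUset !sub1set ae ve.
by apply: map_f; exact: IH.
Qed.

Hypothesis d_gt0 : (0 < d)%N.

Lemma card_edges_through (a v : V) : a != v ->
  (#|[set e in PE | [set a; v] \subset e]| <= n ^ d.-1)%N.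
Proof.
move=> av; have := card_supersets [set a; v] d.-1.
rewrite card_ord cards2 av addn2 prednK//; apply: leq_trans.
by apply/subset_leq_card/subsetP => e; rewrite !inE.
Qed.

Lemma size_walks m a : (size (walks m a) <= (n ^ d) ^ m)%N.
Proof.
elim: m a => [|m IH] a //=.
rewrite expnS -[in X in (X * _)%N](prednK d_gt0) expnS -mulnA.
apply: leq_trans (size_flatten_leq (k := (n ^ d.-1 * (n ^ d) ^ m)%N) _) _.
  move=> v; rewrite mem_enum !inE eq_sym => av.
  apply: leq_trans (size_flatten_leq (k := ((n ^ d) ^ m)%N) _) _.
    by move=> e _; rewrite size_map.
  by rewrite leq_mul2r -cardE card_edges_through// orbT.
by rewrite leq_mul2r -cardE (leq_trans (max_card _)) ?card_ord// orbT.
Qed.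

(** The triples [(a, p, e)] among which the Berge cycles with a walk of [m]
    steps are to be found. *)
Definition cycle_candidates m : seq (V * seq ({set V} * V) * {set V}) :=
  flatten [seq flatten [seq [seq (a, p, e) |
      e <- enum [set e in PE | (walk_end a p != a) && ([set walk_end a p; a] \subset e)]]
    | p <- walks m a] | a <- enum V].

Lemma size_cycle_candidates m :
  (size (cycle_candidates m) <= (n ^ d) ^ m.+1)%N.
Proof.
rewrite expnS -[in X in (X * _)%N](prednK d_gt0) expnS -mulnA.
apply: leq_trans (size_flatten_leq (k := (n ^ d.-1 * (n ^ d) ^ m)%N) _) _.
  move=> a _; apply: leq_trans (size_flatten_leq (k := (n ^ d.-1)%N) _) _.
    move=> p _; rewrite size_map -cardE.
    have [e|ne] := eqVneq (walk_end a p) a.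
      by rewrite (_ : [set e in _ | _] = set0) ?cards0//; apply/setP => f; rewrite !inE andbF.
    by apply: leq_trans (card_edges_through ne); apply/subset_leq_card/subsetP => f; rewrite !inE.
  by rewrite mulnC leq_mul2l size_walks orbT.
by rewrite leq_mul2r -cardE card_ord leqnn orbT.
Qed.

Lemma mem_cycle_candidates (H : {set {set V}}) a p e : H \subset PE ->
  berge_cycle H a p e -> (a, p, e) \in cycle_candidates (size p).
Proof.
move=> HE /and5P[wp pa pe ae /andP[_ /= /andP[eH pH]]].
apply/flattenP; eexists; first by apply: (map_f _ (x := a)); rewrite mem_enum.
apply/flattenP; eexists.
  apply: (map_f _ (x := p)); apply: mem_walks => //.
  by apply/allP => f /(allP pH); exact: (subsetP HE).
apply: map_f; rewrite mem_enum inE (subsetP HE)//= pa subUset !sub1set pe.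
by rewrite ae.
Qed.

Lemma size_walk m a p : p \in walks m a -> size p = m.
Proof.
elim: m a p => [|m IH] a p /=; first by rewrite inE => /eqP ->.
move=> /flattenP[_ /mapP[v _ ->] /flattenP[_ /mapP[e _ ->] /mapP[w wv ->]]].
by rewrite /= (IH _ _ wv).
Qed.

Lemma size_cycle_walk m t : t \in cycle_candidates m -> size t.1.2 = m.
Proof.
move=> /flattenP[_ /mapP[a _ ->] /flattenP[_ /mapP[p pa ->] /mapP[e _ ->]]] /=.
exact: size_walk pa.
Qed.

Variables (R : realType) (q : R).
Hypothesis q01 : 0 <= q <= 1.

Lemma prob_berge_cycle a p e :
  prob q PE (fun H => berge_cycle H a p e) <= q ^+ (size p).+1.
Proof.
have /andP[q0 q1] := q01.
pose A := [set f in e :: map fst p].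
have [/andP[uA AE]|nA] := boolP (uniq (e :: map fst p) && (A \subset PE)).
  have -> : (size p).+1 = #|A|.
    by rewrite /A cardsE (card_uniqP uA) /= size_map.
  rewrite -(prob_sub q AE); apply: (le_prob q01) => H _ /and5P[_ _ _ _ /andP[_ pH]].
  by apply/subsetP => f; rewrite inE => /(allP pH).
apply: le_trans (exprn_ge0 _ q0); rewrite -(expect_cst q PE 0).
apply: (le_expect q01) => H HE; rewrite lern0 eqb0.
apply: contra nA => /and5P[_ _ _ _ /andP[-> pH]]; apply/subsetP => f.
by rewrite inE => /(allP pH); exact: (subsetP HE).
Qed.

Lemma acyclicPn (H : {set {set V}}) :
  ~ acyclic H -> exists t, berge_cycle H t.1.1 t.1.2 t.2.
Proof.
move=> nH; apply: contrapT => nex; apply: nH => a p e.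
by apply/negP => ape; apply: nex; exists (a, p, e).
Qed.

Lemma not_cyclic (H : {set {set V}}) : ~~ `[< ~ acyclic H >] -> acyclic H.
Proof. by move=> nH; apply: contrapT => cH; move: nH; rewrite asboolT. Qed.

(** The expected number of Berge cycles with [m] edges is at most [y ^+ m],
    because [(n ^ d) ^ m] candidates have probability [q ^+ m] each. A Berge cycle
    has at least two edges, so these numbers add up to at most
    [y ^+ 2 / (1 - y)]. *)
Lemma prob_cyclic (y := (n ^ d)%:R * q) : y <= 1/2 ->
  prob q PE (fun H => `[< ~ acyclic H >]) <= 2 * y ^+ 2.
Proof.
move=> y2; have /andP[q0 q1] := q01.
have y0 : 0 <= y by rewrite mulr_ge0.
pose M := #|{set V}|.
pose L := flatten [seq cycle_candidates m.+1 | m <- iota 0 M].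
apply: (@le_trans _ _ (prob q PE (fun H =>
    has (fun t => berge_cycle H t.1.1 t.1.2 t.2) L))).
  apply: (le_prob q01) => H HE /asboolP/acyclicPn[[[a p] e] /= ape].
  apply/hasP; exists (a, p, e) => //.
  have /and5P[_ pa _ _ /andP[up _]] := ape.
  have p0 : (0 < size p)%N by case: p pa {ape up} => //; rewrite eqxx.
  have pM : (size p < M)%N.
    have := max_card (mem (e :: map fst p)).
    by rewrite (card_uniqP up) /= size_map.
  apply/flattenP; exists (cycle_candidates (size p)).
    apply/mapP; exists (size p).-1; rewrite ?prednK// mem_iota /= add0n.
    exact: leq_ltn_trans (leq_pred _) pM.
  exact: mem_cycle_candidates ape.
apply: le_trans (prob_union_bound q01 _ _ _) _; rewrite big_flatten big_map.
apply: (@le_trans _ _ (\sum_(m <- iota 0 M) y ^+ m.+2)).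
  apply: ler_sum => m _.
  apply: (@le_trans _ _ (\sum_(t <- cycle_candidates m.+1) q ^+ m.+2)).
    rewrite big_seq [leRHS]big_seq; apply: ler_sum => t tm.
    by rewrite -(size_cycle_walk tm); exact: prob_berge_cycle.
  rewrite big_const_seq count_predT iter_addr_0 -mulr_natl.
  rewrite /y exprMn -natrX; apply: ler_wpM2r; first exact: exprn_ge0.
  by rewrite ler_nat size_cycle_candidates.
have -> : \sum_(m <- iota 0 M) y ^+ m.+2 = y ^+ 2 * \sum_(m < M) y ^+ m.
  rewrite -(big_mkord xpredT (fun m => y ^+ m)) /index_iota subn0 mulr_sumr.
  by apply: eq_bigr => m _; rewrite -exprD.
rewrite mulrC ler_wpM2r ?sqr_ge0//.
have G0 : 0 <= \sum_(m < M) y ^+ m by apply: sumr_ge0 => m _; exact: exprn_ge0.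
have yM : 0 <= y ^+ M by exact: exprn_ge0.
have := subrX1 y M; move: (y ^+ M) (\sum_(m < M) _) yM G0 => Y G Y0 G0 e.
have y21 : 0 <= 1 - y - 1 / 2 by rewrite subr_ge0; move: y2; lra.
have := mulr_ge0 y21 G0; move: e Y0; move: y {y0 y2 y21} => z; lra.
Qed.

End SparseHypergraphs.

(** * Copies of trees *)

Section Embedding.
Variables (V W : finType) (g : V -> W).
Hypothesis gi : injective g.
Implicit Types (T H : {set {set V}}) (e C : {set V}).

Definition embed T : {set {set W}} := [set g @: (e : {set V}) | e in T].

Lemma mem_embed T e : (g @: e \in embed T) = (e \in T).
Proof. by rewrite mem_imset//; exact: imset_inj. Qed.

Lemma card_embed T : #|embed T| = #|T|.
Proof. by rewrite card_imset//; exact: imset_inj. Qed.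

Lemma embed_inj : injective embed.
Proof. by apply: imset_inj; exact: imset_inj. Qed.

Lemma imset_subE e C : (g @: e \subset g @: C) = (e \subset C).
Proof.
apply/idP/idP => [/subsetP eC|]; last exact: imsetS.
by apply/subsetP => x xe; rewrite -(mem_imset _ _ gi) eC ?imset_f.
Qed.

Lemma imset_disjointE e C : [disjoint g @: e & g @: C] = [disjoint e & C].
Proof.
rewrite -!setI_eq0 -imsetI; last by move=> x y _ _; exact: gi.
by rewrite -!cards_eq0 card_imset.
Qed.

Lemma imset_preimset_sub (D : {set W}) : D \subset g @: [set: V] ->
  g @: (g @^-1: D) = D.
Proof.
move=> DV; apply/setP => y; apply/imsetP/idP => [[x + ->]|yD].
  by rewrite inE.
have /imsetP[x _ yx] := subsetP DV _ yD.
by exists x => //; rewrite inE -yx.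
Qed.

Lemma closed_in_embed T C : closed_in (embed T) (g @: C) = closed_in T C.
Proof.
apply/forall_inP/forall_inP => HC e eT.
  by have := HC (g @: e); rewrite mem_embed imset_disjointE imset_subE => /(_ eT).
by case/imsetP: eT => f fT ->; rewrite imset_disjointE imset_subE HC.
Qed.

Lemma closed_in_preimset T (D : {set W}) :
  closed_in (embed T) D -> closed_in T (g @^-1: D).
Proof.
move=> /closed_inP HD; apply/closed_inP => e x eT xe; rewrite inE => gx.
have := HD (g @: e) (g x); rewrite mem_embed imset_f// => /(_ eT isT gx) /subsetP sub.
by apply/subsetP => y ye; rewrite inE sub ?imset_f.
Qed.

Lemma comp_embed T x : component (embed T) (g x) = g @: component T x.
Proof.
have sub : component (embed T) (g x) \subset g @: component T x.
  by rewrite comp_sub ?closed_in_embed ?closed_in_comp ?imset_f ?mem_comp.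
apply/eqP; rewrite eqEsubset sub /=.
rewrite -(@imset_preimset_sub (component (embed T) (g x))); last first.
  by apply: subset_trans sub _; apply: imsetS; exact: subsetT.
apply: imsetS; apply: comp_sub; last by rewrite inE mem_comp.
exact/closed_in_preimset/closed_in_comp.
Qed.

Lemma inside_embed T C : inside (embed T) (g @: C) = embed (inside T C).
Proof.
apply/setP => f; rewrite inE; apply/andP/imsetP => [[/imsetP[e eT ->]]|[e + ->]].
  by rewrite imset_subE => eC; exists e => //; rewrite inE eT.
by rewrite inE => /andP[eT eC]; rewrite mem_embed imset_subE.
Qed.

Lemma cover_embed T : cover (embed T) = g @: cover T.
Proof.
apply/setP => y; apply/bigcupP/imsetP => [[_ /imsetP[e eT ->] /imsetP[x xe ->]]|[x /bigcupP[e eT xe] ->]].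
  by exists x => //; apply/bigcupP; exists e.
by exists (g @: e); rewrite ?mem_embed ?imset_f.
Qed.

Lemma embedP (E : {set {set W}}) : (forall e : {set W}, e \in E -> e \subset g @: [set: V]) ->
  E = embed [set e : {set V} | g @: e \in E].
Proof.
move=> EV; apply/setP => f; apply/idP/imsetP => [fE|[e + ->]]; last by rewrite inE.
by exists (g @^-1: f); rewrite ?inE imset_preimset_sub ?EV.
Qed.

End Embedding.

Section Trees.
Variables (d : nat).

Lemma embed_potential v n (g : 'I_v -> 'I_n) (T : {set {set 'I_v}}) :
  injective g -> (embed g T \subset potential_edges d n) = (T \subset potential_edges d v).
Proof.
move=> gi; apply/subsetP/subsetP => TE e eT.
  by have := TE (g @: e); rewrite mem_embed// !inE card_imset// => /(_ eT).
by case/imsetP: eT => f /TE + ->; rewrite !inE card_imset.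
Qed.

(** A hypertree on labelled vertices: given connectedness, acyclicity amounts to
    the relation between the numbers of vertices and edges. *)
Definition tree v (T : {set {set 'I_v}}) : bool :=
  [&& T \subset potential_edges d v, v == (d * #|T| + 1)%N &
      [forall C, closed_in T C && (C != set0) ==> (C == [set: 'I_v])]].

Lemma tree_min v (T : {set {set 'I_v}}) C : tree T -> closed_in T C -> C != set0 ->
  C = [set: 'I_v].
Proof. by case/and3P => _ _ /forallP /(_ C) + TC C0; rewrite TC C0 => /eqP. Qed.

Lemma card_potential_edge n (H : {set {set 'I_n}}) : H \subset potential_edges d n ->
  {in H, forall e : {set 'I_n}, #|e| = d.+1}.
Proof. by move=> /subsetP HE e /HE; rewrite inE => /eqP. Qed.

Lemma enum_embedding (W : finType) (S : {set W}) v : #|S| = v ->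
  exists2 g : 'I_v -> W, injective g & g @: [set: 'I_v] = S.
Proof.
move=> cS; exists (fun i => enum_val (cast_ord (esym cS) i)).
  by move=> i j /enum_val_inj /(congr1 val) /= ij; exact: val_inj.
apply/setP => y; apply/imsetP/idP => [[i _ ->]|yS]; first exact: enum_valP.
exists (cast_ord cS (enum_rank_in yS y)) => //.
by rewrite cast_ordK enum_rankK_in.
Qed.

(** The components of an acyclic hypergraph become trees by numbering their
    vertices. *)
Lemma comp_tree n (H : {set {set 'I_n}}) x r :
  H \subset potential_edges d n -> acyclic H ->
  exists v (T : {set {set 'I_v}}), [/\ tree T, #|T| = #|inside H (component H x)| &
    set_type d T r setT = set_type d H r (component H x)].
Proof.
move=> HE acH; set S := component H x; set I := inside H S.
have [v cS] : exists v, #|S| = v by exists #|S|.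
have [g gi gS] := enum_embedding cS.
pose T := [set e : {set 'I_v} | g @: e \in I].
have IT : I = embed g T.
  by apply: embedP => e; rewrite gS inE => /andP[].
have cT : #|T| = #|I| by rewrite IT card_embed.
exists v, T; split=> //.
- apply/and3P; split.
  + rewrite -(embed_potential _ gi) -IT; apply: subset_trans HE.
    by apply/subsetP => e; rewrite inE => /andP[].
  + by rewrite cT -cS; apply/eqP; exact: card_comp_acyclic (card_potential_edge HE).
  + apply/forallP => C; apply/implyP => /andP[TC C0].
    rewrite -(closed_in_embed gi) -IT in TC.
    have CS : g @: C \subset S by rewrite -gS imsetS// subsetT.
    have gC0 : g @: C != set0 by rewrite -cards_eq0 card_imset// cards_eq0.
    have HC : closed_in H (g @: C).
      apply/closed_inP => e y eH ye yC; have /closed_inP TC' := TC.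
      apply: (TC' e y) => //; rewrite inE eH /S -(comp_eq (subsetP CS _ yC)).
      exact: edge_sub_comp.
    have := comp_min HC gC0 CS; rewrite -/S -gS => e.
    by rewrite -(inj_eq (imset_inj gi)) e.
- have -> : set_type d H r S = set_type d I r (g @: [set: 'I_v]).
    rewrite gS; apply: set_type_local; apply/setP => e.
    by rewrite !inE -andbA andbb.
  apply/esym/set_type_inj => // e _; by rewrite IT mem_embed.
Qed.

Variables (n v : nat).
Implicit Types (S : {set 'I_n}) (T : {set {set 'I_v}}) (H : {set {set 'I_n}}).

(** A copy of [T] with vertex set [S], if [S] has [v] elements. One of the possible
    copies on [S] is singled out, so that there are exactly ['C(n, v)]
    candidates, indexed by sets of vertices. *)
Definition copy S T : {set {set 'I_n}} :=
  if [pick g : {ffun 'I_v -> 'I_n} | injectiveb g && (g @: [set: 'I_v] == S)] is Some g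
  then embed g T else set0.

Lemma copyP S T : #|S| = v ->
  exists2 g : 'I_v -> 'I_n, injective g & g @: [set: 'I_v] = S /\ copy S T = embed g T.
Proof.
move=> cS; rewrite /copy; case: pickP => [g /andP[/injectiveP gi /eqP gS]|no].
  by exists g.
have [g gi gS] := enum_embedding cS.
have /negP[] := negbT (no (finfun g)); apply/andP; split.
  by apply/injectiveP => i j; rewrite !ffunE => /gi.
by apply/eqP; rewrite -gS; apply: eq_imset => i; rewrite ffunE.
Qed.

(** The vertex sets of the singled out copies that are components of [H]. *)
Definition copies T H : {set {set 'I_n}} :=
  [set S : {set 'I_n} | (#|S| == v) && (touch H S == copy S T)].

Lemma touch_inside H S : H \subset potential_edges d n -> closed_in H S ->
  touch H S = inside H S.
Proof.
move=> HE /forall_inP HS; apply/setP => e; rewrite !inE; apply: andb_id2l => eH.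
apply/idP/idP => [eS|eS]; first exact: (implyP (HS e eH)).
have /card_gt0P[x xe] : (0 < #|e|)%N by rewrite (card_potential_edge HE).
exact: meets_intro xe (subsetP eS _ xe).
Qed.

Lemma copies_comp T H S : H \subset potential_edges d n -> tree T ->
  S \in copies T H ->
  [/\ closed_in H S, forall x, x \in S -> component H x = S,
      #|inside H S| = #|T|, S != set0 &
      forall r, set_type d H r S = set_type d T r setT].
Proof.
move=> HE tT; rewrite inE => /andP[/eqP cS /eqP HS].
have [g gi [gS cp]] := copyP T cS; rewrite {}cp in HS.
have /and3P[TE /eqP vT _] := tT.
have HSc : closed_in H S.
  apply/closed_inP => e x eH xe xS.
  have : e \in touch H S by rewrite inE eH (meets_intro xe xS).
  by rewrite HS => /imsetP[f _ ->]; rewrite -gS imsetS// subsetT.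
have inS : inside H S = embed g T by rewrite -touch_inside.
have S0 : S != set0 by rewrite -card_gt0 cS vT addn1.
split=> //.
- move=> x xS; have CS : component H x \subset S by exact: comp_sub.
  have gC : g @: (g @^-1: component H x) = component H x.
    by apply: imset_preimset_sub; rewrite gS.
  have TC : closed_in T (g @^-1: component H x).
    rewrite -(closed_in_embed gi) gC -inS; apply/closed_inP => e y.
    by rewrite inE => /andP[eH _]; exact: closed_inP (closed_in_comp H x) e y eH.
  have C0 : g @^-1: component H x != set0.
    apply/set0Pn; have : x \in g @: [set: 'I_v] by rewrite gS.
    by case/imsetP => i _ xi; exists i; rewrite inE -xi mem_comp.
  by rewrite -gC (tree_min tT TC C0).
- by rewrite inS card_embed.
- move=> r; rewrite -(@set_type_inj d _ _ g T (embed g T) setT r gi); last first.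
    by move=> e _; rewrite mem_embed.
  rewrite gS -inS; apply: set_type_local.
  by apply/setP => e; rewrite !inE -andbA andbb.
Qed.

Variables (R : realType) (q : R).
Hypothesis q01 : 0 <= q <= 1.
Local Notation PE := (potential_edges d n).
Local Notation is_copy T S := (fun H => touch H S == copy S T).

Lemma touch_setI H S : H \subset PE -> touch H S = H :&: touch PE S.
Proof.
move=> HE; apply/setP => e; rewrite !inE; case: (boolP (e \in H)) => //= eH.
by have := subsetP HE _ eH; rewrite inE => ->.
Qed.

Lemma copy_sub_touch T S : T \subset potential_edges d v -> #|S| = v ->
  [/\ copy S T \subset touch PE S, forall e, e \in copy S T -> e \subset S &
    #|copy S T| = #|T|].
Proof.
move=> TE cS; have [g gi [gS ->]] := copyP T cS.
have sub e : e \in embed g T -> e \subset S.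
  by case/imsetP => f _ ->; rewrite -gS imsetS// subsetT.
have gE : embed g T \subset PE by rewrite embed_potential.
split=> //; last exact: card_embed.
apply/subsetP => e eT; rewrite in_set (subsetP gE _ eT) /=.
have /card_gt0P[x xe] : (0 < #|e|)%N by rewrite (card_potential_edge gE).
exact: meets_intro xe (subsetP (sub _ eT) _ xe).
Qed.

Lemma bernoulli m : 1 - m%:R * q <= (1 - q) ^+ m.
Proof.
have /andP[q0 q1] := q01; elim: m => [|m IH]; first by rewrite mul0r subr0 expr0.
have q1' : 0 <= 1 - q by rewrite subr_ge0.
rewrite exprS; apply: le_trans (ler_wpM2l q1' IH).
have : 0 <= m%:R * (q * q) :> R by rewrite !mulr_ge0.
rewrite -natr1; move: (m%:R : R) => M; lra.
Qed.

Lemma prob_copy T S : T \subset potential_edges d v -> #|S| = v ->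
  q ^+ #|T| * (1 - (v * n ^ d)%:R * q) <= prob q PE (is_copy T S) <= q ^+ #|T|.
Proof.
have /andP[q0 q1] := q01; move=> TE cS.
have [cpS _ cT] := copy_sub_touch TE cS.
have tS : touch PE S \subset PE by apply/subsetP => e; rewrite inE => /andP[].
have -> : prob q PE (is_copy T S) = q ^+ #|T| * (1 - q) ^+ #|touch PE S :\: copy S T|.
  rewrite -cT -(prob_block q cpS tS); apply: eq_expect => H HE.
  by rewrite touch_setI.
apply/andP; split.
  apply: ler_wpM2l; first exact: exprn_ge0.
  apply: le_trans (bernoulli _); rewrite lerD2l lerN2; apply: ler_wpM2r => //.
  rewrite ler_nat -cS; apply: leq_trans (card_touch _ _).
  exact/subset_leq_card/subsetDl.
by apply: ler_piMr; rewrite ?exprn_ge0// exprn_ile1 ?subr_ge0// gerBl.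
Qed.

(** Components that overlap are equal; copies on disjoint sets have disjoint sets
    of edges. *)
Lemma prob_two_copies T S S' : tree T -> #|S| = v -> #|S'| = v -> S != S' ->
  prob q PE (fun H => is_copy T S H && is_copy T S' H) <= q ^+ #|T| * q ^+ #|T|.
Proof.
have /andP[q0 q1] := q01; move=> tT cS cS' SS'.
have /and3P[TE _ _] := tT.
have [cpS inS cT] := copy_sub_touch TE cS.
have [cpS' inS' cT'] := copy_sub_touch TE cS'.
have [dj|ndj] := boolP [disjoint S & S'].
  have A0 : [disjoint copy S T & copy S' T].
    apply/pred0P => e; apply/negP => /andP[/= eS eS'].
    have eP : e \in touch PE S by exact: (subsetP cpS).
    have : ~~ [disjoint e & S] by move: eP; rewrite inE => /andP[].
    case/meets_witness => x xe xS; have := disjointFr dj xS.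
    by rewrite (subsetP (inS' _ eS')).
  rewrite -exprD -{1}cT -cT' -(cardsUI (copy S T)).
  have /eqP -> : copy S T :&: copy S' T == set0 by rewrite setI_eq0.
  rewrite cards0 addn0 -(prob_sub q (C := PE)); last first.
    rewrite subUset (subset_trans cpS) ?(subset_trans cpS')//;
    by apply/subsetP => e; rewrite inE => /andP[].
  apply: (le_prob q01) => H HE /andP[/eqP HS /eqP HS'].
  by rewrite -HS -HS' subUset; apply/andP; split; apply/subsetP => e; rewrite inE => /andP[].
apply: (@le_trans _ _ 0); last by rewrite mulr_ge0 ?exprn_ge0.
rewrite -(expect_cst q PE 0); apply: (le_expect q01) => H HE.
rewrite lern0 eqb0; apply/negP => /andP[HS HS'].
have SC : S \in copies T H by rewrite inE cS eqxx.
have SC' : S' \in copies T H by rewrite inE cS' eqxx.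
have [_ CS _ _ _] := copies_comp HE tT SC.
have [_ CS' _ _ _] := copies_comp HE tT SC'.
have [x xS xS'] := meets_witness ndj.
by move: SS'; rewrite -(CS _ xS) (CS' _ xS') eqxx.
Qed.

(** By the second moment method, the copies of [T] that are components are
    numerous once their approximate expected number [mu] is large. *)
Lemma prob_few_copies T r (mu := 'C(n, v)%:R * q ^+ #|T|) :
  tree T -> 0 < mu -> 2 * r%:R <= mu ->
  prob q PE (fun H => (#|copies T H| < r)%N) <=
    4 / mu + 8 * ((v * n ^ d)%:R * q).
Proof.
move=> tT mu0 rmu; have /andP[q0 q1] := q01.
have /and3P[TE _ _] := tT.
set delta := (v * n ^ d)%:R * q.
pose X H : R := #|copies T H|%:R.
pose P (S : {set 'I_n}) := #|S| == v.
have XE H : X H = \sum_(S | P S) (is_copy T S H)%:R.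
  rewrite /X /copies -sum1dep_card natr_sum [in RHS]big_mkcond [in LHS]big_mkcond.
  by apply: eq_bigr => S _; rewrite /P; case: (_ == v); case: (_ == _).
have sumP (a : R) : \sum_(S | P S) a = 'C(n, v)%:R * a.
  rewrite sumr_const -[in RHS](card_ord n) -card_draws cardsE mulr_natl.
  by [].
have EX1 : mu * (1 - delta) <= expect q PE X.
  rewrite (@eq_expect _ _ q PE _ (fun H => \sum_(S | P S) (is_copy T S H)%:R)); last by move=> H _.
  rewrite expect_sum /mu -mulrA -sumP; apply: ler_sum => S /eqP cS.
  by have /andP[] := prob_copy TE cS.
have EX2 : expect q PE (fun H => X H * X H) <= mu + mu * mu.
  rewrite (@eq_expect _ _ q PE _ (fun H => \sum_(S | P S) \sum_(S' | P S')
      (is_copy T S H && is_copy T S' H)%:R)); last first.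
    move=> H _; rewrite XE mulr_suml; apply: eq_bigr => S _.
    by rewrite mulr_sumr; apply: eq_bigr => S' _; rewrite -natrM mulnb.
  have -> : mu + mu * mu = \sum_(S | P S) (q ^+ #|T| + \sum_(S' | P S') q ^+ #|T| * q ^+ #|T|).
    rewrite sumP sumP /mu; move: ('C(n, v)%:R : R) (q ^+ #|T|) => a b.
    by rewrite mulrDr; congr (_ + _); rewrite mulrACA -!mulrA.
  rewrite expect_sum; apply: ler_sum => S PS.
  rewrite expect_sum (bigD1 S)//=; apply: lerD.
    rewrite (@eq_expect _ _ q PE _ (fun H => (is_copy T S H)%:R)); last by move=> H _; rewrite andbb.
    by have /andP[_] := prob_copy TE (eqP PS).
  apply: le_trans (_ : \sum_(S' | P S' && (S' != S)) q ^+ #|T| * q ^+ #|T| <= _).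
    apply: ler_sum => S' /andP[PS' SS']; apply: prob_two_copies => //; try exact/eqP.
    by rewrite eq_sym.
  rewrite [leRHS](bigD1 S)//= lerDr mulr_ge0// exprn_ge0//.
clearbody mu delta.
(* Deviations are measured from [mu], which is close to the mean. *)
have EXmu : expect q PE (fun H => (X H - mu) * (X H - mu)) <= mu + 2 * delta * (mu * mu).
  have -> : expect q PE (fun H => (X H - mu) * (X H - mu)) =
      expect q PE (fun H => X H * X H) - 2 * mu * expect q PE X + mu * mu.
    rewrite -(expectZ _ _ (2 * mu)) -expectB -[X in _ + X](expect_cst q PE) -expectD.
    by apply: eq_expect => H _; ring.
  have : 2 * mu * (mu * (1 - delta)) <= 2 * mu * expect q PE X.
    by apply: ler_wpM2l EX1; rewrite mulr_ge0// ltW.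
  move: EX2; move: (expect _ _ _) (expect _ _ _) => a b; lra.
have half : prob q PE (fun H => (#|copies T H| < r)%N) * (mu * mu / 4) <=
    expect q PE (fun H => (X H - mu) * (X H - mu)).
  rewrite mulrC -expectZ; apply: (le_expect q01) => H _.
  case: ltnP => Xr; last by rewrite mulr0 -expr2 sqr_ge0.
  have Xr' : X H <= r%:R by rewrite ler_nat ltnW.
  have h : mu / 2 <= mu - X H by move: Xr' rmu; move: (X H) (r%:R) => a b; lra.
  rewrite mulr1.
  have -> : (X H - mu) * (X H - mu) = (mu - X H) * (mu - X H) by ring.
  have -> : mu * mu / 4 = (mu / 2) * (mu / 2) by field.
  by apply: ler_pM => //; rewrite divr_ge0// ltW.
have mu4 : 0 < mu * mu / 4 by rewrite divr_gt0// mulr_gt0.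
rewrite -(ler_pM2r mu4); apply: le_trans half _; apply: le_trans EXmu _.
have -> : (4 / mu + 8 * delta) * (mu * mu / 4) = mu + 2 * delta * (mu * mu).
  by field; rewrite gt_eqF.
exact: lexx.
Qed.

End Trees.

(** * Special components *)

Section SpecialComponents.
Variables (d k : nat).

Section OneHypergraph.
Variable n : nat.
Local Notation V := 'I_n.
Local Notation PE := (potential_edges d n).
Implicit Types (H A : {set {set V}}) (e f U : {set V}).

(** Components with the numbers of edges and vertices of a tree with [k] edges. *)
Definition special_vertex H x :=
  (#|inside H (component H x)| == k) && (#|component H x| == (d * k + 1)%N).

Definition special H : {set {set V}} :=
  [set e in H | [exists x in e, special_vertex H x]].

Lemma special_sub H : special H \subset H.
Proof. by apply/subsetP => e; rewrite inE => /andP[]. Qed.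

Lemma mem_special H e x : e \in H -> x \in e -> (e \in special H) = special_vertex H x.
Proof.
move=> eH xe; rewrite inE eH /=; apply/exists_inP/idP => [[y ye]|sx]; last by exists x.
have xy : x \in component H y by exact: (subsetP (edge_sub_comp eH ye)).
by rewrite /special_vertex (comp_eq xy).
Qed.

Lemma edge_nonempty H e : H \subset PE -> e \in H -> exists x, x \in e.
Proof.
by move=> HE eH; apply/card_gt0P; rewrite (card_potential_edge HE).
Qed.

Lemma touch_cover H : H \subset PE -> touch H (cover H) = H.
Proof.
move=> HE; apply/setP => e; rewrite inE; apply: andb_idr => eH.
have [x xe] := edge_nonempty HE eH.
by apply: (meets_intro xe); apply/bigcupP; exists e.
Qed.

Lemma touch_special H : H \subset PE -> touch H (cover (special H)) = special H.
Proof.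
move=> HE; apply/setP => e; rewrite in_set.
apply/andP/idP => [[eH /meets_witness[x xe /bigcupP[f fs xf]]]|es].
  have fH := subsetP (special_sub H) _ fs.
  by rewrite (mem_special eH xe) -(mem_special fH xf).
have eH := subsetP (special_sub H) _ es; split=> //.
have [x xe] := edge_nonempty HE eH.
by apply: (meets_intro xe); apply/bigcupP; exists e.
Qed.

Lemma closed_in_of_touch H U : (forall e, e \in touch H U -> e \subset U) -> closed_in H U.
Proof.
move=> HU; apply/forall_inP => e eH; apply/implyP => eU.
by apply: HU; rewrite inE eH.
Qed.

Lemma closed_in_special H : H \subset PE -> closed_in H (cover (special H)).
Proof.
move=> HE; apply: closed_in_of_touch => e; rewrite touch_special// => es.
exact: bigcup_sup.
Qed.

(** Whether an edge is special is a local property, as components are. *)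
Lemma special_transfer H A U e : H \subset PE -> A \subset PE ->
  touch H U = touch A U -> closed_in H U -> ~~ [disjoint e & U] ->
  (e \in special H) = (e \in special A).
Proof.
move=> HE AE HA HU eU.
have eHA f : ~~ [disjoint f & U] -> (f \in H) = (f \in A).
  by move=> fU; move/setP/(_ f): HA; rewrite !inE fU !andbT.
have [eH|eH] := boolP (e \in H); last first.
  by rewrite !inE -eHA// (negbTE eH).
have [x xe xU] := meets_witness eU.
have eA : e \in A by rewrite -eHA.
rewrite (mem_special eH xe) (mem_special eA xe) /special_vertex.
rewrite -(comp_transfer HA HU xU); congr ((_ == _) && _).
apply: eq_card => f; rewrite !inE; apply: andb_id2r => fx.
have sub : f \in H \/ f \in A -> ~~ [disjoint f & U].
  move=> fHA; have [y yf] : exists y, y \in f by case: fHA; exact: edge_nonempty.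
  by apply: meets_intro yf (subsetP (comp_sub HU xU) _ (subsetP fx _ yf)).
apply/idP/idP => fH; have fU := sub _.
  by rewrite -eHA// fU//; left.
by rewrite eHA// fU//; right.
Qed.

(** The event that the special components have edge set [A] splits into an
    event on the edges that meet [cover A] and an event on the others. *)
Lemma special_eqE H A : H \subset PE -> A \subset PE ->
  (special H == A) = [&& special A == A, H :&: touch PE (cover A) == A &
                        special (H :\: touch PE (cover A)) == set0].
Proof.
move=> HE AE; set U := cover A; set H' := H :\: touch PE U.
have H'E : H' \subset PE by apply: subset_trans HE; exact: subsetDl.
have touchC : closed_in H U -> touch H (~: U) = touch H' (~: U).
  move=> HU; apply/setP => e; rewrite in_set [RHS]in_set [e \in H']in_setD.
  have [eH|] := boolP (e \in H); last by rewrite andbF.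
  rewrite in_set (subsetP HE _ eH) !andbT /=; apply/idP/andP => [eU|[]//]; split=> //.
  apply/negP => /meets_witness[x xe xU]; have [y ye yU] := meets_witness eU.
  move: yU; rewrite inE => /negP[].
  exact: subsetP (closed_inP _ _ HU _ _ eH xe xU) _ ye.
have offU e : e \in PE -> ~~ (~~ [disjoint e & U]) -> ~~ [disjoint e & ~: U].
  rewrite negbK => eP eU; have [x xe] := edge_nonempty (subxx _) eP.
  by apply: (meets_intro xe); rewrite inE (disjointFr eU xe).
apply/idP/and3P => [/eqP HA|[/eqP AA /eqP HU /eqP H'0]].
  have HU : closed_in H U by rewrite /U -HA; exact: closed_in_special.
  have tA : touch H U = touch A U by rewrite touch_cover// /U -HA touch_special.
  split.
  - rewrite eqEsubset special_sub; apply/subsetP => e eA.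
    rewrite -(special_transfer HE AE tA HU) ?HA//.
    by move: (eA); rewrite -{1}(touch_cover AE) inE => /andP[].
  - by rewrite -(touch_setI _ HE) tA touch_cover.
  - rewrite -subset0; apply/subsetP => e eH'.
    have e1 := subsetP (special_sub _) _ eH'; have eP := subsetP H'E _ e1.
    have eU : ~~ (~~ [disjoint e & U]).
      by move: e1; rewrite in_setD in_set eP => /andP[].
    have := special_transfer HE H'E (touchC HU) (closed_inC HU) (offU _ eP eU).
    rewrite eH' HA -{1}(touch_cover AE) in_set => /andP[_ eU'].
    by rewrite eU' in eU.
have tA : touch H U = touch A U by rewrite (touch_setI _ HE) HU touch_cover.
have cl : closed_in H U.
  apply: closed_in_of_touch => e; rewrite tA touch_cover// => eA.
  exact: bigcup_sup.
apply/eqP/setP => e; have [eP|eP] := boolP (e \in PE); last first.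
  transitivity false; first by apply: contraNF eP => /(subsetP (special_sub _))/(subsetP HE).
  by apply/esym; apply: contraNF eP; exact: (subsetP AE).
have [eU|eU] := boolP (~~ [disjoint e & U]).
  by rewrite (special_transfer HE AE tA cl eU) AA.
rewrite (special_transfer HE H'E (touchC cl) (closed_inC cl) (offU _ eP eU)) H'0 inE.
apply/esym; apply: contraNF eU; rewrite -{1}(touch_cover AE) in_set.
by case/andP.
Qed.

(** Double counting of the pairs of a vertex and an edge in the same special
    component. *)
Lemma special_density A : A \subset PE -> special A = A ->
  (k * #|cover A| = (d * k + 1) * #|A|)%N.
Proof.
move=> AE AA.
have sv e x : e \in A -> x \in e -> special_vertex A x.
  by move=> eA xe; rewrite -(mem_special eA xe) AA.
transitivity (\sum_(x in cover A) \sum_(e in A | e \subset component A x) 1)%N.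
  rewrite mulnC -sum_nat_const; apply: eq_bigr => x /bigcupP[e eA xe].
  have /andP[/eqP <- _] := sv _ _ eA xe.
  by rewrite -sum1_card; apply: eq_bigl => f; rewrite inE.
rewrite (exchange_big_dep (fun e => e \in A))/=; last by move=> x e _ /andP[].
rewrite mulnC -sum_nat_const; apply: eq_bigr => e eA.
have [y ye] := edge_nonempty AE eA.
have /andP[_ /eqP <-] := sv _ _ eA ye.
rewrite -sum1_card; apply: eq_bigl => x; rewrite eA /=.
apply/andP/idP => [[xA /subsetP/(_ _ ye) yx]|xy].
  by rewrite (comp_eq yx) mem_comp.
rewrite (comp_eq xy) edge_sub_comp//; split=> //.
have cA : closed_in A (cover A).
  by apply: closed_in_of_touch => f; rewrite touch_cover// => fA; exact: bigcup_sup.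
apply: (subsetP (comp_sub cA _) _ xy).
by apply/bigcupP; exists e.
Qed.

Lemma card_cover_leq A : A \subset PE -> (#|cover A| <= #|A| * d.+1)%N.
Proof.
move=> AE; apply: leq_trans (leq_card_bigcup _ _) _; rewrite -sum_nat_const.
by apply: leq_sum => e eA; rewrite (card_potential_edge AE).
Qed.

Variables (R : realType) (q : R).
Hypothesis q01 : 0 <= q <= 1.

Definition no_special := prob q PE (fun H => special H == set0).

Lemma touchPE U : touch PE U \subset PE.
Proof. by apply/subsetP => e; rewrite inE => /andP[]. Qed.

Lemma prob_touched U :
  prob q PE (fun H => H :&: touch PE U != set0) <= (#|U| * n ^ d)%:R * q.
Proof.
have /andP[q0 q1] := q01.
apply: (@le_trans _ _ (prob q PE (fun H => has (fun e => [set e] \subset H) (enum (touch PE U))))).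
  apply: (le_prob q01) => H _ /set0Pn[e /setIP[eH eU]].
  by apply/hasP; exists e; rewrite ?mem_enum ?sub1set.
apply: le_trans (prob_union_bound q01 _ _ _) _.
rewrite big_enum /=; apply: (@le_trans _ _ (\sum_(e in touch PE U) q)).
  apply: ler_sum => e eU; rewrite prob_sub ?cards1 ?expr1// sub1set.
  exact: (subsetP (touchPE U)).
by rewrite sumr_const -[q *+ _]mulr_natl ler_wpM2r// ler_nat card_touch.
Qed.

(** The event on the edges that meet [cover A] has probability close to
    [q ^+ #|A|]; the other one is the absence of special components when the
    edges that meet [cover A] are deleted, and deleting them most often changes
    nothing, as there are none. *)
Lemma prob_special_eq A (delta := (#|cover A| * n ^ d)%:R * q) :
  A \subset PE -> special A = A ->
  `|prob q PE (fun H => special H == A) - q ^+ #|A| * no_special| <=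
    q ^+ #|A| * (2 * delta).
Proof.
move=> AE AA; have /andP[q0 q1] := q01.
set U := cover A; pose t := touch PE U.
have At : A \subset t.
  apply/subsetP => e eA; rewrite in_set (subsetP AE _ eA) /=.
  by have := eA; rewrite -{1}(touch_cover AE) in_set => /andP[].
pose b := prob q PE (fun H => special (H :\: t) == set0).
have -> : prob q PE (fun H => special H == A) = q ^+ #|A| * ((1 - q) ^+ #|t :\: A| * b).
  rewrite mulrA -(expect_block q (fun H => (special H == set0)%:R) At (touchPE U)).
  by apply: eq_expect => H HE; rewrite special_eqE// AA eqxx /= -natrM mulnb.
rewrite -mulrBr normrM ger0_norm ?exprn_ge0//; apply: ler_wpM2l; first exact: exprn_ge0.
have bQ : `|b - no_special| <= delta.
  apply: le_trans (prob_touched U); apply: (prob_dist q01) => H HE.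
  rewrite negbK => HU; suff -> : H :\: t = H by [].
  by apply/setDidPl; rewrite -setI_eq0.
have b0 : 0 <= b by exact: prob_ge0.
have b1 : b <= 1 by exact: prob_le1.
have a1 : (1 - q) ^+ #|t :\: A| <= 1 by rewrite exprn_ile1 ?subr_ge0// gerBl.
have ad : 1 - delta <= (1 - q) ^+ #|t :\: A|.
  apply: le_trans (bernoulli q01 _); rewrite lerD2l lerN2; apply: ler_wpM2r => //.
  rewrite ler_nat; apply: leq_trans (card_touch _ _).
  exact/subset_leq_card/subsetDl.
move: bQ b0 b1 a1 ad; move: (_ ^+ _) b no_special delta => a {}b Q {}delta.
rewrite !ler_norml => /andP[bQ1 bQ2] b0 b1 a1 ad.
have h1 : 0 <= b * (1 - a) by rewrite mulr_ge0// subr_ge0.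
have h2 : b * (1 - a) <= 1 - a by rewrite ler_piMl// subr_ge0.
have -> : a * b = b - b * (1 - a) by ring.
by move: (b * (1 - a)) h1 h2 => c h1 h2; apply/andP; split; lra.
Qed.

End OneHypergraph.

Lemma special_embed w n (g : 'I_w -> 'I_n) (A : {set {set 'I_w}}) :
  injective g -> special (embed g A) = embed g (special A).
Proof.
move=> gi; have sv x : special_vertex (embed g A) (g x) = special_vertex A x.
  by rewrite /special_vertex comp_embed// inside_embed// card_embed// card_imset.
apply/setP => f; rewrite in_set; apply/andP/imsetP.
  case=> /imsetP[e eA ->] /exists_inP[_ /imsetP[x xe ->]]; rewrite sv => sx.
  by exists e => //; rewrite (mem_special eA xe).
case=> e; rewrite in_set => /andP[eA /exists_inP[x xe sx]] ->.
by rewrite mem_embed//; split=> //; apply/exists_inP; exists (g x); rewrite ?imset_f ?sv.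
Qed.

Variables (r : nat) (f : pred (type_code d r 0)).

(** The possible edge sets of the special components, with [a] edges and with
    a type in [f]. *)
Definition special_sets n a : {set {set {set 'I_n}}} :=
  [set A : {set {set 'I_n}} | [&& A \subset potential_edges d n, special A == A,
    #|A| == a & f (set_type d A r (cover A))]].

Lemma special_sets_embed w n (g : 'I_w -> 'I_n) (A : {set {set 'I_w}}) a :
  injective g -> (embed g A \in special_sets n a) = (A \in special_sets w a).
Proof.
move=> gi; rewrite !inE embed_potential// special_embed// (inj_eq (embed_inj gi)).
rewrite card_embed// cover_embed//.
by rewrite (@set_type_inj d _ _ g A (embed g A)) // => e _; rewrite mem_embed.
Qed.

(** One chooses the vertex set, numbers it, and then chooses edges that cover it;
    being special and having a type in [f] are invariant under numbering. *)
Lemma card_special_sets_cover n w a :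
  #|[set A in special_sets n a | #|cover A| == w]| =
  ('C(n, w) * #|[set A in special_sets w a | cover A == setT]|)%N.
Proof.
rewrite -sum1_card (partition_big (fun A : {set {set 'I_n}} => cover A)
  (fun U : {set 'I_n} => #|U| == w)) /=; last by move=> A; rewrite inE => /andP[].
rewrite -[n in 'C(n, w)]card_ord -card_draws -sum_nat_const.
apply: eq_big => [U|U /eqP cU]; first by rewrite inE.
have [g gi gU] := enum_embedding cU.
rewrite sum1dep_card -(card_imset _ (embed_inj gi)); apply: eq_card => A.
rewrite inE; apply/andP/imsetP => [[]|[A0 + ->]].
  rewrite inE => /andP[As _] /eqP AU.
  have AE : A = embed g [set e : {set 'I_w} | g @: e \in A].
    by apply: embedP => e eA; rewrite gU -AU; exact: bigcup_sup.
  exists [set e : {set 'I_w} | g @: e \in A] => //.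
  rewrite inE -(special_sets_embed _ _ gi) -AE As -(inj_eq (imset_inj gi)).
  by rewrite -(cover_embed gi) -AE AU gU eqxx.
rewrite inE => /andP[A0s /eqP cA0].
by rewrite inE special_sets_embed// A0s (cover_embed gi) cA0 gU cU !eqxx.
Qed.

(** The number of vertices is determined by [special_density]. *)
Lemma card_special_sets n m : (0 < k)%N ->
  #|special_sets n (k * m)| = ('C(n, (d * k + 1) * m) *
    #|[set A in special_sets ((d * k + 1) * m) (k * m) | cover A == setT]|)%N.
Proof.
move=> k0; rewrite -card_special_sets_cover; apply: eq_card => A.
rewrite [RHS]in_set; apply/esym/andb_idr; rewrite in_set => /and4P[AE /eqP AA /eqP cA _].
have := special_density AE AA; rewrite cA mulnCA => /eqP.
by rewrite eqn_pmul2l.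
Qed.

Lemma special_sets_dvd n a A : A \in special_sets n a -> (k %| a)%N.
Proof.
rewrite inE => /and4P[AE /eqP AA /eqP <- _].
have := dvdn_mulr #|cover A| (dvdnn k); rewrite special_density// mulnDl mul1n.
by rewrite dvdn_addr// mulnAC dvdn_mull.
Qed.

End SpecialComponents.

Section Pieces.
Variables (d n : nat).
Local Notation V := 'I_n.
Local Notation PE := (potential_edges d n).

(** These include the subtrees with [k] edges, for the appropriate [v], and their
    number is at most a constant times [n ^ v]. *)
Definition pieces v k : {set {set V} * {set {set V}}} :=
  [set P : {set V} * {set {set V}} | [&& #|P.1| == v, P.2 \subset powerset P.1, #|P.2| == k & P.2 \subset PE]].

Lemma card_pieces v k : (#|pieces v k| <= n ^ v * 2 ^ (2 ^ v))%N.
Proof.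
apply: (@leq_trans (\sum_(S : {set V} | #|S| == v) \sum_(A in powerset (powerset S)) 1)%N).
  rewrite pair_big_dep /= sum1dep_card; apply/subset_leq_card/subsetP => -[S A].
  by rewrite !inE /= => /and4P[-> ].
apply: (@leq_trans (\sum_(S : {set V} | #|S| == v) 2 ^ (2 ^ v))%N).
  by apply: leq_sum => S /eqP cS; rewrite sum1_card !card_powerset cS.
rewrite sum_nat_const leq_mul2r; apply/orP; right.
apply: leq_trans (bin_leq_exp _ _); rewrite -[n in 'C(n, v)]card_ord -card_draws.
by rewrite cardsE.
Qed.

Variables (R : realType) (q : R).
Hypothesis q01 : 0 <= q <= 1.

Lemma sum_pieces v k :
  \sum_(P in pieces v k) prob q PE (fun H => P.2 \subset H) <=
    (2 ^ (2 ^ v))%:R * ((n ^ v)%:R * q ^+ k).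
Proof.
have /andP[q0 q1] := q01.
apply: (@le_trans _ _ (\sum_(P in pieces v k) q ^+ k)).
  apply: ler_sum => P; rewrite inE => /and4P[_ _ /eqP <- PPE].
  by rewrite prob_sub.
rewrite sumr_const -[_ *+ _]mulr_natl mulrA ler_wpM2r ?exprn_ge0//.
by rewrite -natrM ler_nat mulnC card_pieces.
Qed.

Lemma prob_piece v k :
  prob q PE (fun H => [exists P in pieces v k, P.2 \subset H]) <=
    (2 ^ (2 ^ v))%:R * ((n ^ v)%:R * q ^+ k).
Proof.
apply: le_trans (sum_pieces v k).
rewrite -[leRHS]big_enum /=; apply: le_trans (prob_union_bound q01 _ _ _).
apply: (le_prob q01) => H _ /exists_inP[P PP PH].
by apply/hasP; exists P; rewrite ?mem_enum.
Qed.

Lemma expect_card_special k (v := (d * k + 1)%N) :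
  expect q PE (fun H => #|special d k H|%:R) <=
    k%:R * ((2 ^ (2 ^ v))%:R * ((n ^ v)%:R * q ^+ k)).
Proof.
apply: le_trans (ler_wpM2l (ler0n _ k) (sum_pieces v k)).
rewrite -expect_sum -expectZ; apply: (le_expect q01) => H HE.
rewrite -natr_sum -natrM ler_nat.
pose F (P : {set V} * {set {set V}}) := if P.2 \subset H then P.2 else set0.
apply: (@leq_trans #|\bigcup_(P in pieces v k) F P|).
  apply/subset_leq_card/subsetP => e; rewrite in_set => /andP[eH /exists_inP[x xe]].
  move=> /andP[ck cv]; apply/bigcupP; exists (component H x, inside H (component H x)).
    rewrite inE /= cv ck /=; apply/andP; split.
      by apply/subsetP => h; rewrite !inE => /andP[].
    by apply: subset_trans HE; apply/subsetP => h; rewrite inE => /andP[].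
  rewrite /F /= ifT; first by rewrite inE eH edge_sub_comp.
  by apply/subsetP => h; rewrite inE => /andP[].
apply: leq_trans (leq_card_bigcup _ _) _; rewrite big_distrr /=.
apply: leq_sum => P; rewrite inE => /and4P[_ _ /eqP <- _].
by rewrite /F; case: ifP => _; rewrite ?muln1 ?cards0.
Qed.

(** Markov's inequality for the number of special edges. *)
Lemma prob_many_special k N (v := (d * k + 1)%N) :
  prob q PE (fun H => (N < #|special d k H|)%N) * N.+1%:R <=
    k%:R * ((2 ^ (2 ^ v))%:R * ((n ^ v)%:R * q ^+ k)).
Proof.
apply: le_trans (expect_card_special k); rewrite mulrC -expectZ.
apply: (le_expect q01) => H _; rewrite -natrM ler_nat.
by case: ltnP => h; rewrite ?muln1 ?muln0.
Qed.

End Pieces.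

(** * Limits of the probabilities of exceptional events *)

Section GoodHypergraphs.
Variables (d r K : nat).

(** Two good hypergraphs of any sizes cannot be told apart in [r] rounds off [Z]:
    the types of their components are the same, and each one is so frequent that
    multiplicities do not matter. *)
Definition good n (Z : {set 'I_n}) (H : {set {set 'I_n}}) : Prop :=
  [/\ forall x, x \notin Z -> exists v (T : {set {set 'I_v}}),
        [/\ tree d T, (#|T| <= K)%N & set_type d T r setT = set_type d H r (component H x)],
      forall v (T : {set {set 'I_v}}), tree d T -> (#|T| <= K)%N ->
        (r <= #|copies T H|)%N &
      forall v (T : {set {set 'I_v}}) S, tree d T -> (#|T| <= K)%N ->
        S \in copies T H -> [disjoint S & Z]].

Lemma good_rich n n' (H : {set {set 'I_n}}) (H' : {set {set 'I_n'}}) Z Z' :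
  H' \subset potential_edges d n' -> good Z H -> good Z' H' -> rich d H H' r Z Z'.
Proof.
move=> HE' [typ _ _] [_ cop off] x /typ[v [T [tT TK eT]]].
exists (copies T H'); first exact: cop.
move=> C CT; have [_ CS _ /set0Pn[y yC] typC] := copies_comp HE' tT CT.
split; last by rewrite typC.
by exists y; [rewrite CS|rewrite (disjointFr (off _ _ _ tT TK CT) yC)].
Qed.

Lemma good_sat n n' (H : {set {set 'I_n}}) (H' : {set {set 'I_n'}}) Z Z' (phi : sentence d) :
  H \subset potential_edges d n -> H' \subset potential_edges d n' ->
  closed_in H Z -> closed_in H' Z' -> good Z H -> good Z' H' ->
  set_type d H r Z = set_type d H' r Z' -> (quantifier_rank phi <= r)%N ->
  models H phi = models H' phi.
Proof.
move=> HE HE' HZ HZ' gH gH' ZZ' rphi.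
by apply: (rich_sat (r := r) HZ HZ') => //; exact: good_rich.
Qed.

(** The number of vertices of a tree being determined by its number [e] of edges,
    this is a quantification over a finite set of trees. *)
Definition few_copies n (H : {set {set 'I_n}}) : bool :=
  [exists e : 'I_K.+1, exists T : {set {set 'I_(d * e + 1)}},
    [&& tree d T, #|T| == e & (#|copies T H| < r)%N]].

Lemma many_copies n (H : {set {set 'I_n}}) v (T : {set {set 'I_v}}) :
  ~~ few_copies H -> tree d T -> (#|T| <= K)%N -> (r <= #|copies T H|)%N.
Proof.
move=> few tT TK; rewrite leqNgt; apply: contra few => cT.
have [e eT] : exists e, #|T| = e by exists #|T|.
have /and3P[_ /eqP vT _] := tT; rewrite eT in TK vT; subst v.
apply/existsP; exists (Ordinal (TK : (e < K.+1)%N)).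
by apply/existsP; exists T; rewrite tT eT eqxx.
Qed.

End GoodHypergraphs.

Section Limits.
Variable R : realType.
Local Open Scope classical_set_scope.

Lemma cvg_approx (u : nat -> R) :
  (forall e : R, 0 < e -> exists2 w : nat -> R, cvg (w n @[n --> \oo]) &
     \forall n \near \oo, `|u n - w n| <= e) ->
  cvg (u n @[n --> \oo]).
Proof.
move=> H; apply: cauchy_cvg; apply: cauchy_exP => e e0.
have e2 : 0 < e / 2 by rewrite divr_gt0.
have [w wc uw] := H _ e2; exists (lim (w n @[n --> \oo])).
move/cvgrPdist_lt: wc => /(_ _ e2) wl.
apply: filterS2 uw wl => n h1 h2; rewrite /ball /=.
have -> : lim (w n @[n --> \oo]) - u n = (lim (w n @[n --> \oo]) - w n) - (u n - w n) by ring.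
by apply: le_lt_trans (ler_normB _ _) _; rewrite [e]splitr ltr_leD.
Qed.

Lemma cvg_eq (u : nat -> R) (a b : R) :
  u n @[n --> \oo] --> a -> a = b -> u n @[n --> \oo] --> b.
Proof. by move=> ua <-. Qed.

Lemma cvg_near_eq (u w : nat -> R) (a : R) :
  u n @[n --> \oo] --> a -> (\forall n \near \oo, u n = w n) ->
  w n @[n --> \oo] --> a.
Proof.
move=> ua uw; apply: cvg_trans ua; apply: near_eq_cvg.
by apply: filterS uw => n ->.
Qed.

Lemma cvg_squeeze0 (u w : nat -> R) :
  (\forall n \near \oo, 0 <= u n <= w n) -> w n @[n --> \oo] --> (0 : R) ->
  u n @[n --> \oo] --> (0 : R).
Proof. move=> uw w0; refine (@squeeze_cvgr _ _ _ _ (fun=> 0) w u uw 0 _ w0); exact: cvg_cst. Qed.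

(** As [w] is fixed, ['C(n, w)] is equivalent to [n ^ w / w`!]. *)
Lemma cvg_bin_exp w :
  ('C(n, w)%:R / (n ^ w)%:R : R) @[n --> \oo] --> (w`!%:R^-1 : R).
Proof.
have H : ((n ^_ w)%:R / (n ^ w)%:R : R) @[n --> \oo] --> (1 : R).
  elim: w => [|w IH].
    by apply: (@cvg_near_eq (fun=> 1)); [exact: cvg_cst|apply: nearW => n; rewrite divr1].
  apply: (@cvg_near_eq (fun n => (n ^_ w)%:R / (n ^ w)%:R * (1 - w%:R * n%:R^-1))).
    apply: (@cvg_eq _ (1 * (1 - w%:R * 0))); last by rewrite mulr0 subr0 mulr1.
    apply: cvgM => //; apply: cvgB; first exact: cvg_cst.
    apply: cvgM; first exact: cvg_cst.
    apply/gtr0_cvgV0; last exact: cvgr_idn.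
    by near=> n; rewrite ltr0n; near: n; exact: nbhs_infty_gt.
  near=> n; have wn : (w < n)%N by near: n; exact: nbhs_infty_gt.
  rewrite ffactnSr expnSr !natrM natrB; last exact: ltnW.
  have n0 : n%:R != 0 :> R by rewrite pnatr_eq0 -lt0n (leq_ltn_trans _ wn).
  have nw0 : (n ^ w)%:R != 0 :> R by rewrite natrX expf_neq0.
  by field; rewrite n0 nw0.
apply: (@cvg_near_eq (fun n => (n ^_ w)%:R / (n ^ w)%:R * w`!%:R^-1)).
  apply: (@cvg_eq _ (1 * w`!%:R^-1)); last by rewrite mul1r.
  by apply: cvgM => //; exact: cvg_cst.
apply: nearW => n; rewrite -bin_ffact natrM -!mulrA; congr (_ * _).
by rewrite mulrCA divff ?mulr1// pnatr_eq0 -lt0n fact_gt0.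
Unshelve. all: by end_near. Qed.

Lemma cvg_pow (u : nat -> R) (a : R) m :
  u n @[n --> \oo] --> a -> u n ^+ m @[n --> \oo] --> a ^+ m.
Proof.
move=> ua; elim: m => [|m IH].
  by apply: (@cvg_near_eq (fun=> 1)); [exact: cvg_cst|exact: nearW].
apply: (@cvg_near_eq (fun n => u n * u n ^+ m)).
  by rewrite exprS; exact: cvgM.
by apply: nearW => n; rewrite exprS.
Qed.

Lemma cvg_sum_seq (I : Type) (s : seq I) (P : pred I) (u : I -> nat -> R) (a : I -> R) :
  (forall i, P i -> u i n @[n --> \oo] --> a i) ->
  \sum_(i <- s | P i) u i n @[n --> \oo] --> \sum_(i <- s | P i) a i.
Proof.
move=> ua; elim: s => [|i s IH].
  rewrite big_nil; apply: (@cvg_near_eq (fun=> 0)); first exact: cvg_cst.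
  by apply: nearW => n; rewrite big_nil.
rewrite big_cons; case: (boolP (P i)) => Pi; last first.
  by apply: cvg_near_eq IH _; apply: nearW => n; rewrite big_cons (negbTE Pi).
apply: (@cvg_near_eq (fun n => u i n + \sum_(j <- s | P j) u j n)).
  by apply: cvgD => //; exact: ua.
by apply: nearW => n; rewrite big_cons Pi.
Qed.

Lemma cvg_sum0 (I : finType) (u : I -> nat -> R) :
  (forall i, u i n @[n --> \oo] --> (0 : R)) ->
  \sum_i u i n @[n --> \oo] --> (0 : R).
Proof.
move=> u0; apply: cvg_eq (cvg_sum_seq (a := fun=> 0) _) _ => //.
by rewrite big1.
Qed.

End Limits.

Lemma prob_exists (R : realType) (E : finType) (q : R) (C : {set E}) (I : finType)
    (P : I -> pred {set E}) : 0 <= q <= 1 ->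
  prob q C (fun H => [exists i, P i H]) <= \sum_i prob q C (P i).
Proof.
move=> q01; rewrite -[leRHS]big_enum; apply: le_trans (prob_union_bound q01 _ _ _).
apply: (le_prob q01) => H _ /existsP[i Pi].
by apply/hasP; exists i; rewrite ?mem_enum.
Qed.

Section SparseSequences.
Variables (R : realType) (d : nat) (p : nat -> R).
Hypothesis d_gt0 : (0 < d)%N.
Hypothesis p01 : forall n, 0 <= p n <= 1.
Local Open Scope classical_set_scope.
Local Notation PE := (potential_edges d).
Local Notation y := (fun n => (n ^ d)%:R * p n).
Hypothesis y0 : y n @[n --> \oo] --> (0 : R).

(** The expected number of subtrees with [j] edges, up to a constant. *)
Definition tree_count j n : R := (n ^ (d * j + 1))%:R * p n ^+ j.

Lemma tree_count_ge0 j n : 0 <= tree_count j n.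
Proof. by have /andP[p0 _] := p01 n; rewrite mulr_ge0// exprn_ge0. Qed.

Lemma tree_countS j n : tree_count j.+1 n = tree_count j n * y n.
Proof.
rewrite /tree_count mulnS -addnA expnD natrM exprS; ring.
Qed.

Lemma cyclic_cvg0 :
  prob (p n) (PE n) (fun H => `[< ~ acyclic H >]) @[n --> \oo] --> (0 : R).
Proof.
apply: (@cvg_squeeze0 _ _ (fun n => 2 * (y n * y n))).
  have : \forall n \near \oo, y n <= 1 / 2 by apply: (cvgr_le _ y0); rewrite divr_gt0.
  apply: filterS => n yn; rewrite prob_ge0//= -expr2.
  exact: prob_cyclic.
apply: (@cvg_eq _ _ (2 * (0 * 0))); last by rewrite !mulr0.
by apply: cvgM; [exact: cvg_cst|exact: cvgM].
Qed.

Lemma piece_cvg0 j : tree_count j n @[n --> \oo] --> (0 : R) ->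
  prob (p n) (PE n) (fun H => [exists P in pieces d n (d * j + 1) j, P.2 \subset H])
    @[n --> \oo] --> (0 : R).
Proof.
move=> x0; pose c : R := (2 ^ (2 ^ (d * j + 1)))%:R.
apply: (@cvg_squeeze0 _ _ (fun n => c * tree_count j n)).
  by apply: nearW => n; rewrite prob_ge0//=; exact: prob_piece.
apply: (@cvg_eq _ _ (c * 0)); last by rewrite mulr0.
by apply: cvgM => //; exact: cvg_cst.
Qed.

(** The mean of the number of copies is [tree_count] up to a factor that tends to
    [v`!%:R^-1]. *)
Lemma copies_cvg0 r v (T : {set {set 'I_v}}) : tree d T ->
  tree_count #|T| n @[n --> \oo] --> +oo ->
  prob (p n) (PE n) (fun H => (#|copies T H| < r)%N) @[n --> \oo] --> (0 : R).
Proof.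
move=> tT xoo; have /and3P[_ /eqP vT _] := tT.
pose mu n : R := 'C(n, v)%:R * p n ^+ #|T|.
have muoo : mu n @[n --> \oo] --> +oo.
  have f0 : 0 < v`!%:R^-1 :> R by rewrite invr_gt0 ltr0n fact_gt0.
  have half : \forall n \near \oo, v`!%:R^-1 / 2 <= ('C(n, v)%:R / (n ^ v)%:R : R).
    apply: (cvgr_ge _ (@cvg_bin_exp R v)).
    by rewrite ltr_pdivrMr// ltr_pMr// ltr1n.
  apply/cvgryPge => A; move/cvgryPge: xoo => /(_ (A / (v`!%:R^-1 / 2))) xA.
  near=> n; have h1 : A / (v`!%:R^-1 / 2) <= tree_count #|T| n by near: n.
  have h2 : v`!%:R^-1 / 2 <= ('C(n, v)%:R / (n ^ v)%:R : R) by near: n.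
  have n0 : (0 < n)%N by near: n; exact: nbhs_infty_gt.
  have nv0 : (n ^ v)%:R != 0 :> R by rewrite pnatr_eq0 -lt0n expn_gt0 n0.
  have -> : mu n = ('C(n, v)%:R / (n ^ v)%:R) * tree_count #|T| n.
    by rewrite /mu /tree_count -vT mulrA divfK.
  apply: le_trans (ler_wpM2r (tree_count_ge0 _ _) h2).
  by rewrite mulrC -ler_pdivrMr// divr_gt0.
apply: (@cvg_squeeze0 _ _ (fun n => 4 * (mu n)^-1 + 8 * (v%:R * y n))).
  have gt0 : \forall n \near \oo, 0 < mu n by move/cvgryPgt: muoo; apply.
  have ge2 : \forall n \near \oo, 2 * r%:R <= mu n by move/cvgryPge: muoo; apply.
  apply: filterS2 gt0 ge2 => n mu0 mu2; rewrite prob_ge0//=.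
  apply: le_trans (prob_few_copies (p01 n) tT mu0 mu2) _.
  by rewrite natrM -[v%:R * _ * _]mulrA.
apply: (@cvg_eq _ _ (4 * 0 + 8 * (v%:R * 0))); last by rewrite !mulr0 addr0.
apply: cvgD; apply: cvgM; try exact: cvg_cst.
  apply/gtr0_cvgV0 => //; move/cvgryPgt: muoo; exact.
by apply: cvgM => //; exact: cvg_cst.
Unshelve. all: by end_near. Qed.

Lemma few_copies_cvg0 r K :
  (forall j, (j <= K)%N -> tree_count j n @[n --> \oo] --> +oo) ->
  prob (p n) (PE n) (fun H => few_copies d r K H) @[n --> \oo] --> (0 : R).
Proof.
move=> xoo; pose u (e : 'I_K.+1) (T : {set {set 'I_(d * e + 1)}}) n :=
  prob (p n) (PE n) (fun H => [&& tree d T, #|T| == e & (#|copies T H| < r)%N]).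
apply: (@cvg_squeeze0 _ _ (fun n => \sum_e \sum_T u e T n)).
  apply: nearW => n; rewrite prob_ge0//=; apply: le_trans (prob_exists _ _ (p01 n)) _.
  by apply: ler_sum => e _; exact: prob_exists.
apply: cvg_sum0 => e; apply: cvg_sum0 => T; rewrite /u.
have [tT|nT] := boolP (tree d T && (#|T| == e)); last first.
  apply: (@cvg_near_eq _ (fun=> 0)); first exact: cvg_cst.
  apply: nearW => n; rewrite -[LHS](expect_cst (p n) (PE n)); apply: eq_expect => H _.
  by rewrite andbA (negbTE nT).
have /andP[tT1 /eqP Te] := tT.
apply: cvg_near_eq (copies_cvg0 r tT1 _) _.
  by rewrite Te; apply: xoo; rewrite -ltnS.
by apply: nearW => n; apply: eq_expect => H _; rewrite tT1 Te eqxx.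
Qed.

End SparseSequences.

(** * The zero-one law when all trees abound *)

(** The type codes of rank [r] are finitely many, so finitely many trees represent
    all those that are realised by trees. *)
Lemma finitely_many_tree_types d r : exists K, forall v (T : {set {set 'I_v}}),
  tree d T -> exists v' (T' : {set {set 'I_v'}}),
    [/\ tree d T', (#|T'| <= K)%N & set_type d T' r setT = set_type d T r setT].
Proof.
have /fin_all_exists[m mP] : forall t : type_code d r 0, exists m,
    forall v (T : {set {set 'I_v}}), tree d T -> set_type d T r setT = t ->
    exists v' (T' : {set {set 'I_v'}}),
      [/\ tree d T', (#|T'| <= m)%N & set_type d T' r setT = t].
  move=> t; have [[v [T [tT Tt]]]|no] := pselect (exists v (T : {set {set 'I_v}}),
      tree d T /\ set_type d T r setT = t).
    by exists #|T| => _ _ _ _; exists v, T.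
  by exists 0%N => v T tT Tt; case: no; exists v, T.
exists (\max_t m t)%N => v T tT; have [v' [T' [tT' T'm e]]] := mP _ v T tT erefl.
by exists v', T'; split=> //; apply: leq_trans T'm _; exact: leq_bigmax.
Qed.

Section Components.
Variables (d n : nat).
Hypothesis d_gt0 : (0 < d)%N.
Local Notation PE := (potential_edges d n).
Implicit Type H : {set {set 'I_n}}.

Lemma no_piece_comp H k x : H \subset PE -> acyclic H ->
  ~~ [exists P in pieces d n (d * k.+1 + 1) k.+1, P.2 \subset H] ->
  (#|inside H (component H x)| <= k)%N.
Proof.
move=> HE acH; apply: contraNleq => kx.
have [S [E [tSE cE xS Sx]]] := subtree_exists acH (card_potential_edge HE) kx.
apply/exists_inP; exists (S, E); last exact: subtree_sub tSE.
rewrite inE /=; apply/and4P; split.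
- by rewrite (subtree_card tSE) cE.
- by apply/subsetP => e eE; rewrite inE; exact: (subtree_inside tSE).
- by rewrite cE.
- exact: subset_trans (subtree_sub tSE) HE.
Qed.

Lemma special_vertex_cover H k x : (0 < k)%N -> special_vertex d k H x ->
  x \in cover (special d k H).
Proof.
move=> k0 sx; have /andP[_ /eqP cx] := sx.
have [/exists_inP[e eH xe]|no] := boolP [exists e in H, x \in e].
  by apply/bigcupP; exists e => //; rewrite (mem_special _ _ eH xe).
have x1 : closed_in H [set x].
  apply/closed_inP => e z eH ze; rewrite inE => /eqP zx.
  by case/exists_inP: no; exists e => //; rewrite -zx.
have := subset_leq_card (comp_sub x1 (set11 x)).
by rewrite cx cards1 addn1 ltnS leqn0 muln_eq0 => /orP[]/eqP; lia.
Qed.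

Lemma special_cover_vertex H k x : x \in cover (special d k H) -> special_vertex d k H x.
Proof.
move=> /bigcupP[e es xe]; have eH := subsetP (special_sub d k H) _ es.
by rewrite -(mem_special d k eH xe).
Qed.

(** A component that is not special has less than [k.+1] edges, and a copy of a
    tree with at most [k] edges is not special. *)
Lemma good_special H r k : H \subset PE -> acyclic H ->
  ~~ [exists P in pieces d n (d * k.+2 + 1) k.+2, P.2 \subset H] ->
  ~~ few_copies d r k H -> good d r k (cover (special d k.+1 H)) H.
Proof.
move=> HE acH noP many; split.
- move=> x xZ; have [v [T [tT cT eT]]] := comp_tree x r HE acH.
  exists v, T; split=> //; rewrite -ltnS ltn_neqAle {1}cT cT no_piece_comp// andbT.
  apply: contra xZ => ck; apply: special_vertex_cover => //.
  rewrite /special_vertex ck; move: ck => /eqP <-.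
  by rewrite (card_comp_acyclic _ acH (card_potential_edge HE)) eqxx.
- by move=> v T; exact: many_copies.
- move=> v T S tT TK ST; have [_ CS cS _ _] := copies_comp HE tT ST.
  apply/pred0P => x; apply/negP => /andP[/= xS /special_cover_vertex/andP[+ _]].
  by rewrite (CS _ xS) cS => /eqP e; rewrite e ltnn in TK.
Qed.

Lemma good_trees H r K : H \subset PE -> acyclic H ->
  (forall v (T : {set {set 'I_v}}), tree d T -> exists v' (T' : {set {set 'I_v'}}),
    [/\ tree d T', (#|T'| <= K)%N & set_type d T' r setT = set_type d T r setT]) ->
  ~~ few_copies d r K H -> good d r K set0 H.
Proof.
move=> HE acH KP many; split.
- move=> x _; have [v [T [tT _ eT]]] := comp_tree x r HE acH.
  have [v' [T' [tT' T'K e]]] := KP v T tT.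
  by exists v', T'; rewrite e.
- by move=> v T; exact: many_copies.
- by move=> v T S _ _ _; rewrite disjoint_sym -setI_eq0 set0I.
Qed.

End Components.

Lemma closed_in_set0 (V : finType) (H : {set {set V}}) : closed_in H set0.
Proof. by apply/closed_inP => e x _ _; rewrite inE. Qed.

Lemma set_type_set0 d n (H : {set {set 'I_n}}) r :
  H \subset potential_edges d n ->
  set_type d H r set0 = set_type d (set0 : {set {set 'I_0}}) r set0.
Proof.
move=> HE; pose g : 'I_0 -> 'I_n := @no_var 'I_n.
have gi : injective g by case.
rewrite -(@set_type_inj d _ _ g _ H _ r gi) ?imset0// => e.
rewrite subset0 => /eqP ->; rewrite imset0 inE.
by apply/negbTE/negP => /(subsetP HE); rewrite inE cards0.
Qed.

Lemma prob_modelsE (R : realType) d n (q : R) (P : sentence d) :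
  prob_models n q P = prob q (potential_edges d n) (fun H => models H P).
Proof.
rewrite /prob_models /prob /expect big_mkcondr; apply: eq_bigr => H _ /=.
by rewrite /hypergraph_mass /subset_mass; case: ifP => _; rewrite ?mulr1 ?mulr0.
Qed.

Section SparseSequences.
Variables (R : realType) (d : nat) (p : nat -> R).
Hypothesis d_gt0 : (0 < d)%N.
Hypothesis p01 : forall n, 0 <= p n <= 1.
Local Open Scope classical_set_scope.
Local Notation PE := (potential_edges d).
Local Notation y := (fun n => (n ^ d)%:R * p n).
Hypothesis y0 : y n @[n --> \oo] --> (0 : R).

Lemma cvg_dist0 (u w b : nat -> R) :
  (\forall n \near \oo, `|u n - w n| <= b n) -> b n @[n --> \oo] --> (0 : R) ->
  forall a : R, w n @[n --> \oo] --> a -> u n @[n --> \oo] --> a.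
Proof.
move=> uwb b0 a wa.
have uw0 : (u n - w n) @[n --> \oo] --> (0 : R).
  apply/norm_cvg0P; apply: (cvg_squeeze0 _ b0).
  by apply: filterS uwb => n h; rewrite normr_ge0.
apply: (@cvg_near_eq _ (fun n => (u n - w n) + w n)).
  by apply: (@cvg_eq _ _ (0 + a)); [exact: cvgD|rewrite add0r].
by apply: nearW => n; rewrite subrK.
Qed.

(** All good hypergraphs, whatever their numbers of vertices, agree on [phi]. *)
Lemma convergence_all_trees (phi : sentence d) :
  (forall j, tree_count d p j n @[n --> \oo] --> +oo) ->
  cvg (prob_models n (p n) phi @[n --> \oo]).
Proof.
move=> xoo; set r := quantifier_rank phi.
have [K KP] := finitely_many_tree_types d r.
pose b := `[< exists n (H : {set {set 'I_n}}),
  [/\ H \subset PE n, good d r K set0 H & models H phi] >].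
have bP n (H : {set {set 'I_n}}) : H \subset PE n -> good d r K set0 H ->
    models H phi = b.
  move=> HE gH; apply/idP/asboolP => [Hphi|[n' [H' [HE' gH' Hphi']]]].
    by exists n, H.
  rewrite (good_sat HE HE' _ _ gH gH') ?closed_in_set0//.
  by rewrite (set_type_set0 r HE) (set_type_set0 r HE').
apply/cvg_ex; exists (b%:R); pose bad n :=
  prob (p n) (PE n) (fun H => `[< ~ acyclic H >]) +
  prob (p n) (PE n) (fun H => few_copies d r K H).
apply: (@cvg_dist0 _ (fun=> b%:R) bad); last exact: cvg_cst.
  apply: nearW => n; rewrite prob_modelsE -[X in _ - X](expect_cst (p n) (PE n)).
  apply: le_trans (prob_dist (p01 n) (P' := fun=> b)
    (Q := fun H => `[< ~ acyclic H >] || few_copies d r K H) _) _.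
    move=> H HE; rewrite negb_or => /andP[/not_cyclic acH many].
    exact: bP (good_trees HE acH KP many).
  exact: prob_or.
apply: (@cvg_eq _ _ (0 + 0)); last by rewrite addr0.
by apply: cvgD; [exact: cyclic_cvg0|apply: few_copies_cvg0 => // j _; exact: xoo].
Qed.

End SparseSequences.

(** * The law at the threshold of the trees with k edges *)

Lemma sum_indicator (R : realType) (T : finType) (S : {set T}) x :
  \sum_(A in S) (x == A)%:R = (x \in S)%:R :> R.
Proof.
have [xS|xS] := boolP (x \in S).
  by rewrite (bigD1 x)//= eqxx big1 ?addr0// => A /andP[_ /negbTE]; rewrite eq_sym => ->.
by rewrite big1// => A AS; case: eqP => // e; rewrite e AS in xS.
Qed.

Lemma sum_indicator_ord (R : realType) m x (b : bool) :
  \sum_(a < m) ((x == a :> nat) && b)%:R = (b && (x < m)%N)%:R :> R.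
Proof.
case: b => /=; last by rewrite big1// => a _; rewrite andbF.
case: ltnP => xm.
  rewrite (bigD1 (Ordinal xm))//= eqxx big1 ?addr0// => a.
  by rewrite -val_eqE /= eq_sym => /negbTE ->.
rewrite big1// => a _; case: eqP => // e; move: (ltn_ord a).
by rewrite -e ltnNge xm.
Qed.

Lemma special_idem d k n (H : {set {set 'I_n}}) : H \subset potential_edges d n ->
  special d k (special d k H) = special d k H.
Proof.
move=> HE; have sE := subset_trans (special_sub d k H) HE.
by have := special_eqE k HE sE; rewrite eqxx => /esym/and3P[/eqP].
Qed.

Lemma special_set0 d k n : special d k (set0 : {set {set 'I_n}}) = set0.
Proof. by apply/eqP; rewrite -subset0; exact: special_sub. Qed.

Section SpecialLimit.
Variables (R : realType) (d k r : nat) (p : nat -> R).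
Hypothesis k_gt0 : (0 < k)%N.
Hypothesis p01 : forall n, 0 <= p n <= 1.
Local Open Scope classical_set_scope.
Local Notation PE := (potential_edges d).
Local Notation y := (fun n => (n ^ d)%:R * p n).
Hypothesis y0 : y n @[n --> \oo] --> (0 : R).
Variable c : R.
Hypothesis xc : tree_count d p k n @[n --> \oo] --> c.
Implicit Type f : pred (type_code d r 0).

(** The sum of [p n ^+ #|A|] over the candidates [A] for the set of special edges
    that have at most [N] edges and a type in [f]. *)
Definition special_sum f N n : R :=
  \sum_(a < N.+1) #|special_sets k f n a|%:R * p n ^+ a.

(** There are ['C(n, w)] times a constant candidates with [m] special components,
    where [w = (d k + 1) m] is the number of their vertices. As [n ^ w p ^ (k m)]
    is the [m]-th power of [tree_count], their contribution converges. *)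
Lemma special_sum_cvg f N : cvg (special_sum f N n @[n --> \oo]).
Proof.
suff /choice[l lP] : forall a, exists l : R,
    (#|special_sets k f n a|%:R * p n ^+ a) @[n --> \oo] --> l.
  apply/cvg_ex; exists (\sum_(a < N.+1) l a).
  by apply: cvg_sum_seq => a _; exact: lP.
move=> a; have [/dvdnP[m ->]|ka] := boolP (k %| a)%N; last first.
  exists 0; apply: (@cvg_near_eq _ (fun=> 0)); first exact: cvg_cst.
  apply: nearW => n; rewrite (_ : special_sets _ _ _ _ = finset.set0) ?cards0 ?mul0r//.
  apply/eqP; rewrite -subset0; apply/subsetP => A /special_sets_dvd.
  by rewrite (negbTE ka).
set w := ((d * k + 1) * m)%N.
pose nu : R := #|[set A in special_sets k f w (k * m) | cover A == setT]%SET|%:R.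
exists (nu * (w`!%:R^-1 * c ^+ m)).
apply: (@cvg_near_eq _ (fun n => nu * ('C(n, w)%:R / (n ^ w)%:R * tree_count d p k n ^+ m))).
  apply: cvgM; first exact: cvg_cst.
  by apply: cvgM; [exact: cvg_bin_exp|exact: cvg_pow].
near=> n; have n0 : (0 < n)%N by near: n; exact: nbhs_infty_gt.
have nw0 : (n ^ w)%:R != 0 :> R by rewrite pnatr_eq0 -lt0n expn_gt0 n0.
rewrite [(m * k)%N]mulnC card_special_sets// -/w natrM -/nu /tree_count.
rewrite exprMn -natrX -expnM -/w -exprM.
by rewrite [_ / _ * (_ * _)]mulrA divfK// mulrA [nu * _]mulrC.
Unshelve. all: by end_near. Qed.

Definition special_type n (H : {set {set 'I_n}}) :=
  set_type d (special d k H) r (cover (special d k H)).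

Definition tail_constant : R := k%:R * (2 ^ (2 ^ (d * k + 1)))%:R.

(** The first error term comes from [prob_special_eq], where a candidate covers at
    most [N * d.+1] vertices; the second one bounds the probability that there
    are more than [N] special edges. *)
Lemma prob_special_type f N n :
  `|prob (p n) (PE n) (fun H => f (special_type H)) -
     special_sum f N n * no_special d k n (p n)| <=
  special_sum f N n * (2 * ((N * d.+1)%:R * y n)) +
    tail_constant * tree_count d p k n / N.+1%:R.
Proof.
have q01 := p01 n; have /andP[q0 q1] := q01; set q := p n; set Q := no_special _ _ _ _.
pose P' (H : {set {set 'I_n}}) := f (special_type H) && (#|special d k H| < N.+1)%N.
have tail : `|prob q (PE n) (fun H => f (special_type H)) - prob q (PE n) P'| <=
    tail_constant * tree_count d p k n / N.+1%:R.
  apply: (@le_trans _ _ (prob q (PE n) (fun H => (N < #|special d k H|)%N))).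
    apply: (prob_dist q01) => H HE; rewrite -leqNgt /P' ltnS => ->.
    by rewrite andbT.
  rewrite ler_pdivlMr ?ltr0n//; apply: le_trans (prob_many_special d n q01 k N) _.
  by rewrite /tail_constant /tree_count mulrA.
have P'E : prob q (PE n) P' = \sum_(a < N.+1) \sum_(A in special_sets k f n a)
    prob q (PE n) (fun H => special d k H == A).
  under eq_bigr do rewrite -expect_sum.
  rewrite -expect_sum; apply: eq_expect => H HE.
  under eq_bigr do rewrite sum_indicator.
  rewrite /P' -sum_indicator_ord; apply: eq_bigr => a _; congr (_%:R); congr nat_of_bool.
  rewrite inE (subset_trans (special_sub d k H) HE) special_idem// eqxx /=.
  by [].
have main : `|prob q (PE n) P' - special_sum f N n * Q| <=
    special_sum f N n * (2 * ((N * d.+1)%:R * y n)).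
  rewrite P'E /special_sum !mulr_suml -sumrB.
  apply: le_trans (ler_norm_sum _ _ _) _; apply: ler_sum => a _.
  have -> : #|special_sets k f n a|%:R * p n ^+ a =
      \sum_(A in special_sets k f n a) p n ^+ a by rewrite sumr_const -[RHS]mulr_natl.
  rewrite !mulr_suml -sumrB; apply: le_trans (ler_norm_sum _ _ _) _.
  apply: ler_sum => A; rewrite inE => /and4P[AE /eqP AA /eqP cA _].
  have := prob_special_eq q01 AE AA; rewrite cA => h; apply: le_trans h _.
  apply: ler_wpM2l; first exact: exprn_ge0.
  rewrite ler_pM2l// mulrA -natrM ler_wpM2r// ler_nat leq_mul2r.
  rewrite (leq_trans (card_cover_leq AE)) ?orbT// cA leq_mul2r -ltnS ltn_ord orbT//.
rewrite -(subrK (prob q (PE n) P') (prob q (PE n) (fun H => f (special_type H)))).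
rewrite -addrA; apply: le_trans (ler_normD _ _) _.
by rewrite [leRHS]addrC; exact: lerD.
Qed.

Lemma special_sum_error f N (e : R) : tail_constant * (c + 1) / N.+1%:R <= e / 2 ->
  0 < e ->
  \forall n \near \oo,
    `|prob (p n) (PE n) (fun H => f (special_type H)) -
      special_sum f N n * no_special d k n (p n)| <= e.
Proof.
move=> Ne e0; have e2 : 0 < e / 2 by rewrite divr_gt0.
have /cvg_ex[g gP] := @special_sum_cvg f N.
have z : (fun n => special_sum f N n * (2 * ((N * d.+1)%:R * y n))) n @[n --> \oo] --> (0 : R).
  apply: (@cvg_eq _ _ (g * (2 * ((N * d.+1)%:R * 0)))); last by rewrite !mulr0.
  apply: cvgM => //; apply: cvgM; first exact: cvg_cst.
  by apply: cvgM => //; exact: cvg_cst.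
have z1 : \forall n \near \oo, special_sum f N n * (2 * ((N * d.+1)%:R * y n)) <= e / 2.
  exact: (cvgr_le _ z).
have x1 : \forall n \near \oo, tree_count d p k n <= c + 1.
  by apply: (cvgr_le _ xc); rewrite ltrDl.
apply: filterS2 z1 x1 => n h1 h2; apply: le_trans (prob_special_type f N n) _.
rewrite [e]splitr; apply: lerD => //; apply: le_trans Ne.
by rewrite ler_wpM2r ?invr_ge0// ler_wpM2l// mulr_ge0.
Qed.

Lemma exists_tail_bound (e : R) : 0 < e ->
  exists N, tail_constant * (c + 1) / N.+1%:R <= e / 2.
Proof.
move=> e0; set a := tail_constant * (c + 1).
have e2 : 0 < e / 2 by rewrite divr_gt0.
exists (Num.truncn (a / (e / 2))); rewrite ler_pdivrMr ?ltr0n// mulrC -ler_pdivrMr//.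
by apply/ltW; rewrite truncnS_gt.
Qed.

(** The total probability being 1, the probability that there is no special
    component is approximately the inverse of [special_sum]. *)
Lemma no_special_cvg : cvg (no_special d k n (p n) @[n --> \oo]).
Proof.
apply: cvg_approx => e e0; have [N Ne] := exists_tail_bound e0.
have G1 n : 1 <= special_sum predT N n.
  rewrite /special_sum big_ord_recl expr0 mulr1 -[1 in leLHS]addr0; apply: lerD.
    rewrite ler1n card_gt0; apply/set0Pn; exists finset.set0.
    by rewrite inE sub0set special_set0 cards0 !eqxx.
  by apply: sumr_ge0 => a _; rewrite mulr_ge0// exprn_ge0//; case/andP: (p01 n).
have /cvg_ex[g gP] := @special_sum_cvg predT N.
have g1 : 1 <= g by apply: (cvgr_to_ge gP); apply: nearW.
exists (fun n => (special_sum predT N n)^-1).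
  apply/cvg_ex; exists g^-1; apply: cvgV => //.
  by rewrite gt_eqF// (lt_le_trans ltr01).
have := special_sum_error predT Ne e0; apply: filterS => n.
rewrite (_ : prob _ _ _ = 1); last exact: expect_cst.
set G := special_sum _ _ _; set Q := no_special _ _ _ _ => h.
have G0 : 0 < G by exact: lt_le_trans (G1 n).
have -> : Q - G^-1 = - ((1 - G * Q) / G) by field; rewrite gt_eqF.
rewrite normrN normrM normfV (gtr0_norm G0) ler_pdivrMr//.
by apply: le_trans h _; apply: ler_peMr; [exact: ltW|exact: G1].
Qed.

Lemma special_type_cvg f :
  cvg (prob (p n) (PE n) (fun H => f (special_type H)) @[n --> \oo]).
Proof.
apply: cvg_approx => e e0; have [N Ne] := exists_tail_bound e0.
exists (fun n => special_sum f N n * no_special d k n (p n)).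
  by apply: is_cvgM; [exact: special_sum_cvg|exact: no_special_cvg].
exact: special_sum_error.
Qed.

End SpecialLimit.

Arguments special_type : clear implicits.
Arguments special_type d k r {n} H.


Section Convergence.
Variables (R : realType) (d : nat) (p : nat -> R).
Hypothesis d_gt0 : (0 < d)%N.
Hypothesis p01 : forall n, 0 <= p n <= 1.
Local Open Scope classical_set_scope.
Local Notation PE := (potential_edges d).
Local Notation y := (fun n => (n ^ d)%:R * p n).
Hypothesis y0 : y n @[n --> \oo] --> (0 : R).

(** When the trees with at most [k] edges abound and those with [k.+1] edges do
    not, a sentence almost surely depends only on the type of the special part. *)
Lemma convergence_special (phi : sentence d) k (c : R) :
  (forall j, (j <= k)%N -> tree_count d p j n @[n --> \oo] --> +oo) ->
  tree_count d p k.+1 n @[n --> \oo] --> c ->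
  cvg (prob_models n (p n) phi @[n --> \oo]).
Proof.
move=> xoo xc; set r := quantifier_rank phi.
pose Z n (H : {set {set 'I_n}}) := cover (special d k.+1 H).
pose f (t : type_code d r 0) := `[< exists n (H : {set {set 'I_n}}),
  [/\ H \subset PE n, good d r k (Z n H) H, special_type d k.+1 r H = t & models H phi] >].
have inZ n (H : {set {set 'I_n}}) : H \subset PE n ->
    set_type d H r (Z n H) = special_type d k.+1 r H.
  move=> HE; apply: set_type_local.
  rewrite -(touch_inside HE (closed_in_special _ HE)) touch_special//.
  apply/setP => e; rewrite [RHS]inE; apply/esym/andb_idr => es.
  exact: bigcup_sup.
have fP n (H : {set {set 'I_n}}) : H \subset PE n -> good d r k (Z n H) H ->
    models H phi = f (special_type d k.+1 r H).
  move=> HE gH; apply/idP/asboolP => [Hphi|[n' [H' [HE' gH' e Hphi']]]].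
    by exists n, H.
  rewrite (good_sat HE HE' _ _ gH gH') ?closed_in_special//.
  by rewrite !inZ.
have x0 : tree_count d p k.+2 n @[n --> \oo] --> (0 : R).
  apply: (@cvg_near_eq _ (fun n => tree_count d p k.+1 n * y n)).
    by apply: (@cvg_eq _ _ (c * 0)); [exact: cvgM|rewrite mulr0].
  by apply: nearW => n; rewrite -tree_countS.
pose piece n (H : {set {set 'I_n}}) :=
  [exists P in pieces d n (d * k.+2 + 1) k.+2, P.2 \subset H].
pose bad n := prob (p n) (PE n) (fun H => `[< ~ acyclic H >]) +
  (prob (p n) (PE n) (@piece n) + prob (p n) (PE n) (fun H => few_copies d r k H)).
have /cvg_ex[l lP] := special_type_cvg (ltn0Sn k) p01 y0 xc (f := f).
apply/cvg_ex; exists l; apply: (@cvg_dist0 _ _ _ bad) lP.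
  apply: nearW => n; rewrite prob_modelsE.
  apply: le_trans (prob_dist (p01 n) (P' := fun H => f (special_type d k.+1 r H))
    (Q := fun H => `[< ~ acyclic H >] || (piece n H || few_copies d r k H)) _) _.
    move=> H HE; rewrite negb_or => /andP[/not_cyclic acH].
    rewrite negb_or => /andP[noP many].
    exact: fP HE (good_special d_gt0 HE acH noP many).
  apply: le_trans (prob_or (p01 n) _ _ _) _; apply: lerD => //; exact: prob_or.
apply: (@cvg_eq _ _ (0 + (0 + 0))); last by rewrite !addr0.
apply: cvgD; first exact: cyclic_cvg0.
by apply: cvgD; [exact: piece_cvg0|exact: few_copies_cvg0].
Qed.

End Convergence.

Lemma L_function_pow (R : realType) (u : nat -> R) m :
  L_function u -> L_function (fun n => u n ^+ m).
Proof.
move=> Lu; elim: m => [|m IH]; first exact: L_const.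
by apply: L_germ (L_mul Lu IH) _; apply: nearW => n; rewrite exprS.
Qed.

Lemma L_function_tree_count (R : realType) d (p : nat -> R) j :
  L_function p -> L_function (tree_count d p j).
Proof.
move=> Lp; apply: L_germ (L_mul (L_function_pow _ (@L_var R)) (L_function_pow j Lp)) _.
by apply: nearW => n; rewrite -natrX.
Qed.

Lemma tree_count0 (R : realType) d (p : nat -> R) : tree_count d p 0 = fun n => n%:R.
Proof. by apply/funext => n; rewrite /tree_count muln0 add0n expn1 expr0 mulr1. Qed.

Local Open Scope classical_set_scope.
Local Open Scope ring_scope.

Theorem theorem3p11 (R : realType) (d : nat) (p : nat -> R)
    (hd : (1 <= d)%N)
    (hp01 : forall n : nat, 0 <= p n <= 1)
    (hL : L_function p)
    (hsmall : much_less p (fun n : nat => n%:R ^- d)) :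
  convergence_law d p.
Proof.
move=> phi.
have y0 : (n ^ d)%:R * p n @[n --> \oo] --> (0 : R).
  apply: cvg_near_eq hsmall _; apply: nearW => n.
  by rewrite /= invrK mulrC natrX.
have dich j : tree_count d p j n @[n --> \oo] --> +oo \/
    cvg (tree_count d p j n @[n --> \oo]).
  apply: L_function_dichotomy; first exact: L_function_tree_count.
  by apply: nearW => n; exact: tree_count_ge0.
have [all|] := pselect (forall j, tree_count d p j n @[n --> \oo] --> +oo).
  exact: convergence_all_trees.
move=> /existsNP nall.
pose P j := `[< ~ tree_count d p j n @[n --> \oo] --> +oo >].
have exP : exists j, P j by case: nall => j nj; exists j; exact/asboolP.
have [[|k] /asboolP Pk minP] := ex_minnP exP.
  by case: Pk; rewrite tree_count0; exact: cvgr_idn.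
have [//|/cvg_ex[c xc]] := dich k.+1.
apply: (convergence_special hd hp01 y0 _ xc) => j jk; apply: contrapT => nj.
have := minP j; rewrite ltnNge jk => kj.
by have := kj (asboolT nj).
Qed.
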